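(* Let $\mathcal{R}$ be a finite index set and let $$\mathcal{G}=\{\, i a_k^\dagger a_k : 1\le k\le n\,\}\cup\{\, g_{\sigma_p}^{\gamma_p} : p\in\mathcal{R}\,\}\subseteq \hat A_n ,$$ where each $g_{\sigma_p}^{\gamma_p}$ ($\sigma_p\in\{+,-\}$, $\gamma_p=(\alpha^{(p)},\beta^{(p)})\in\mathbb{N}_0^{2n}$) is a basis element of $\hat A_n$ that does not lie in $\hat A_n^1$. Let $\mathfrak{g}$ be the real Lie subalgebra of $\hat A_n$ generated by $\mathcal{G}$ (the smallest real subspace containing $\mathcal G$ and closed under commutators). For $K\in\{0,1,2,=,\mathrm{om},\perp\}$ write $\mathcal{G}^K=\mathcal{G}\cap\hat A_n^K$, and let $\mathfrak{c}_{\mathcal G}$ be the set of all elements of $\mathcal{G}$ that commute with every element of $\mathcal{G}$. Then $\mathfrak{g}$ is finite-dimensional if and only if all of the following hold: (i) $\mathcal{G}^\perp=\emptyset$; (ii) $\mathcal{G}^{=}\subseteq\mathfrak{c}_{\mathcal G}$; (iii) $[x,y]\in\hat A_n^{\mathrm{om}}$ for all $x\in\mathcal G^2$ and $y\in\mathcal G^{\mathrm{om}}$; (iv) for all $x,y\in\mathcal G^{\mathrm{om}}$, the orthogonal projection of $[x,y]$ onto $\hat A_n^\perp$ is zero.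
   Context: Fix $n\ge 1$. The Weyl algebra $A_n$ is the unital associative $\mathbb{C}$-algebra generated by $a_1,\dots,a_n,a_1^\dagger,\dots,a_n^\dagger$ subject to $[a_i,a_j^\dagger]=\delta_{ij}$ and $[a_i,a_j]=[a_i^\dagger,a_j^\dagger]=0$, where $[x,y]=xy-yx$. $\mathbb N_0$ denotes the nonnegative integers. For $\gamma=(\alpha,\beta)\in\mathbb N_0^{2n}$ ($\alpha,\beta\in\mathbb N_0^n$) set $a^{\gamma}=(a_1^\dagger)^{\alpha_1}\cdots(a_n^\dagger)^{\alpha_n}a_1^{\beta_1}\cdots a_n^{\beta_n}$ (normal-ordered monomials); these form a $\mathbb C$-basis of $A_n$. Put $|\gamma|=\sum_j\alpha_j+\sum_j\beta_j$. The adjoint $\dagger$ is the conjugate-linear anti-automorphism of $A_n$ with $(a_j)^\dagger=a_j^\dagger$, $(a_j^\dagger)^\dagger=a_j$, $1^\dagger=1$; so $(a^{(\alpha,\beta)})^\dagger=a^{(\beta,\alpha)}$. The skew-hermitian Weyl algebra is $\hat A_n=\{g\in A_n: g^\dagger=-g\}$, a real Lie algebra under the commutator. For a monomial $m$ let $g_+(m)=i(m^\dagger+m)$ and $g_-(m)=m^\dagger-m$, and for $\gamma\in\mathbb N_0^{2n}$ let $g_\pm^\gamma=g_\pm(a^\gamma)$. On $\mathbb N_0^n$ use the lexicographic order ($\alpha>\beta$ iff $\alpha_k>\beta_k$ for the least $k$ with $\alpha_k\ne\beta_k$). A basis element is an element $g_+^{(\alpha,\beta)}$ with $\alpha\ge\beta$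 or $g_-^{(\alpha,\beta)}$ with $\alpha>\beta$; the basis elements form an $\mathbb R$-basis of $\hat A_n$, and $\hat A_n$ carries the inner product for which the basis elements are mutually orthogonal and nonzero; orthogonal projections are taken with respect to it. Subspaces of $\hat A_n$ (real spans of basis elements $g_\sigma^{\gamma}$, $\gamma=(\alpha,\beta)$): $\hat A_n^0$ is spanned by $2i$ and $2ia_k^\dagger a_k$ ($1\le k\le n$), i.e. the basis elements with $\alpha=\beta$, $|\gamma|\in\{0,2\}$; $\hat A_n^1$ by basis elements with $|\gamma|=1$; $\hat A_n^2$ by basis elements with $|\gamma|=2$ and $\alpha\ne\beta$; $\hat A_n^=$ by basis elements with $\alpha=\beta$ and $|\gamma|\ge 4$; $\hat A_n^{\mathrm{om}}$ by basis elements with $|\gamma|\ge3$ for which there is a unique index $k$ with $\alpha_k+\beta_k=1$ and $\alpha_j=\beta_j$ for all $j\neq k$; $\hat A_n^\perp$ by all remaining basis elements. Thus $\hat A_n$ is the orthogonal direct sum of these six subspaces. *)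

(* Defs.v *)
From HB Require Import structures.
From mathcomp Require Import all_boot all_order all_algebra.
From mathcomp Require Import reals.
From mathcomp Require Import complex.
From mathcomp Require Import finmap monalg.

Set Implicit Arguments.
Unset Strict Implicit.
Unset Printing Implicit Defensive.

Import Order.TTheory GRing.Theory Num.Theory.
Local Open Scope ring_scope.
Local Open Scope complex_scope.

Section Weyl.
Context (R : realType) (n : nat).
Local Notation C := (R[i]).

(* Multi-indices gamma = (alpha, beta) in N_0^n x N_0^n; the pair stands
   for the normal-ordered monomial
   a^gamma = (a_1^+)^alpha_1 ... (a_n^+)^alpha_n a_1^beta_1 ... a_n^beta_n. *)
Definition mono := ({ffun 'I_n -> nat} * {ffun 'I_n -> nat})%type.

(* The Weyl algebra A_n, realised on its normal-ordered monomial basis: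
   an element is a finitely supported family of complex coefficients
   indexed by the normal-ordered monomials. *)
Definition weyl := {malg C[mono]}.

Definition iC : C := Complex 0 1.

Definition amon (g : mono) : weyl := << (1 : C) *g g >>.

Definition mdeg (g : mono) : nat := (\sum_(j < n) (g.1 j + g.2 j))%N.

(* Product of two normal-ordered monomials, brought back to normal order.
   Mode by mode (modes commute), with [a, a^+] = 1 one has
     a^b (a^+)^a' = sum_k k! C(b,k) C(a',k) (a^+)^(a'-k) a^(b-k),
   hence
     a^(al,be) a^(al',be') =
       sum_(k <= min(be,al')) prod_j k_j! C(be_j,k_j) C(al'_j,k_j)
                               a^(al+al'-k, be+be'-k).
   k ranges over all multi-indices with k_j <= sum be (larger k_j give a
   vanishing binomial coefficient, as do k_j > min(be_j, al'_j)). *)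
Definition mono_mul (g h : mono) : weyl :=
  \sum_(k : {ffun 'I_n -> 'I_((\sum_(j < n) g.2 j)%N.+1)})
     << ((\prod_(j < n) ('C(g.2 j, k j) * 'C(h.1 j, k j) * (k j)`!))%N)%:R
        *g ([ffun j => g.1 j + h.1 j - k j]%N,
            [ffun j => g.2 j + h.2 j - k j]%N) >>.

Definition wmul (x y : weyl) : weyl :=
  \sum_(g <- msupp x) \sum_(h <- msupp y) (x@_g * y@_h) *: mono_mul g h.

Definition wbr (x y : weyl) : weyl := wmul x y - wmul y x.

Definition wdag (x : weyl) : weyl :=
  \sum_(g <- msupp x) << (x@_g)^* *g (g.2, g.1) >>.

Definition skew (x : weyl) : Prop := wdag x = - x.

Definition gplus (g : mono) : weyl := iC *: (wdag (amon g) + amon g).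
Definition gminus (g : mono) : weyl := wdag (amon g) - amon g.
Definition gsig (sigma : bool) (g : mono) : weyl :=
  if sigma then gplus g else gminus g.

Definition lex_gt (a b : {ffun 'I_n -> nat}) : Prop :=
  exists k : 'I_n, (forall j : 'I_n, (j < k)%N -> a j = b j) /\ (b k < a k)%N.
Definition lex_ge (a b : {ffun 'I_n -> nat}) : Prop := a = b \/ lex_gt a b.

Definition is_basis (sigma : bool) (g : mono) : Prop :=
  if sigma then lex_ge g.1 g.2 else lex_gt g.1 g.2.

Inductive cls := K0 | K1 | K2 | Keq | Kom | Kperp.

Definition cls0 (g : mono) : Prop := g.1 = g.2 /\ (mdeg g = 0 \/ mdeg g = 2)%N.
Definition cls1 (g : mono) : Prop := mdeg g = 1%N.
Definition cls2 (g : mono) : Prop := mdeg g = 2%N /\ g.1 <> g.2.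
Definition clseq (g : mono) : Prop := g.1 = g.2 /\ (4 <= mdeg g)%N.
Definition clsom (g : mono) : Prop :=
  (3 <= mdeg g)%N /\
  exists k : 'I_n, (g.1 k + g.2 k = 1)%N /\
                   forall j : 'I_n, j <> k -> g.1 j = g.2 j.
Definition clsperp (g : mono) : Prop :=
  ~ cls0 g /\ ~ cls1 g /\ ~ cls2 g /\ ~ clseq g /\ ~ clsom g.

Definition in_cls (K : cls) (g : mono) : Prop :=
  match K with
  | K0 => cls0 g | K1 => cls1 g | K2 => cls2 g
  | Keq => clseq g | Kom => clsom g | Kperp => clsperp g
  end.

Definition span_basis (P : bool -> mono -> Prop) (x : weyl) : Prop :=
  exists s : seq (R * (bool * mono)),
    (forall t, t \in s -> is_basis t.2.1 t.2.2 /\ P t.2.1 t.2.2) /\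
    x = \sum_(t <- s) (t.1)%:C *: gsig t.2.1 t.2.2.

Definition subA (K : cls) (x : weyl) : Prop :=
  span_basis (fun _ g => in_cls K g) x.

(* w is the orthogonal projection of z onto \hat A_n^K (for the inner
   product making the basis elements mutually orthogonal): w lies in
   \hat A_n^K and z - w lies in the span of all other basis elements. *)
Definition orth_proj (K : cls) (z w : weyl) : Prop :=
  subA K w /\ span_basis (fun _ g => ~ in_cls K g) (z - w).

Inductive lie_gen (S : weyl -> Prop) : weyl -> Prop :=
  | lg_gen x : S x -> lie_gen S x
  | lg_zero : lie_gen S 0
  | lg_add x y : lie_gen S x -> lie_gen S y -> lie_gen S (x + y)
  | lg_scale (r : R) x : lie_gen S x -> lie_gen S (r%:C *: x)
  | lg_br x y : lie_gen S x -> lie_gen S y -> lie_gen S (wbr x y).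

Definition fin_dim (L : weyl -> Prop) : Prop :=
  exists s : seq weyl, forall x, L x ->
    exists c : seq R, x = \sum_(i < size s) (c`_i)%:C *: s`_i.

Definition num_mono (k : 'I_n) : mono :=
  ([ffun j => nat_of_bool (j == k)], [ffun j => nat_of_bool (j == k)]).

End Weyl.

(* Main.v *)
Require Import Defs.
From HB Require Import structures.
From mathcomp Require Import all_boot all_order all_algebra.
From mathcomp Require Import reals.
From mathcomp Require Import complex.
From mathcomp Require Import finmap monalg.
From mathcomp Require Import zify ring boolp.

Set Implicit Arguments.
Unset Strict Implicit.
Unset Printing Implicit Defensive.

Import Order.TTheory GRing.Theory Num.Theory.

Local Open Scope ring_scope.
Local Open Scope complex_scope.

(* Let A_n act on Laurent monomials z^r: a normal-ordered monomial of weight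
   w = alpha - beta shifts r by w and multiplies by a polynomial in r.  Elements
   of weight 0 are polynomials P in the number operators, and ad_P multiplies an
   element Y of weight w by Q(r) = P(r + w) - P(r); a finite-dimensional Lie
   algebra can therefore contain P and Y only if Q is constant.  The generators
   i a_k^+ a_k split every other generator into a^gamma and its adjoint, so this
   applies with P = [Y, Y^+] (where Q is a second difference of a polynomial of
   degree |gamma|, which excludes generators of type "perp"), with P a generator
   of type "=", and with P = [Z, Z^+] for Z of type "om".  The outcome is a
   decoupling: no generator has nonzero weight in a mode that occurs in one of
   type "=", or that occurs through number operators in one of type "om".
   Conversely, decoupled generators are combinations of monomials which are
   diagonal on a set S of modes and at most quadratic off S, and a weighted
   degree bounds all their iterated brackets.  Finally, (i)-(iv) are equivalent
   to the decoupling, because each violation of it puts a monomial of the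
   forbidden class, with a Poisson bracket as its coefficient, into a
   commutator. *)

(** * Linear and bilinear maps on free modules *)

Section LinearExtension.
Context (K : choiceType) (F : comNzRingType) (V : lmodType F).
Implicit Types (f : K -> V) (x y : {malg F[K]}).

Definition lext f x : V := \sum_(g <- msupp x) x@_g *: f g.

Lemma lextEw f (D : {fset K}) x : (msupp x `<=` D)%fset ->
  lext f x = \sum_(g <- D) x@_g *: f g.
Proof.
move=> sxD; rewrite /lext (big_fset_incl _ sxD) // => g _ /mcoeff_outdom ->.
by rewrite scale0r.
Qed.

Lemma lext_is_linear f : linear (lext f).
Proof.
move=> c x y; set D := (msupp x `|` msupp y)%fset.
have sx : (msupp x `<=` D)%fset by exact: fsubsetUl.
have sy : (msupp y `<=` D)%fset by exact: fsubsetUr.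
have sxy : (msupp (c *: x + y) `<=` D)%fset.
  apply: fsubset_trans (msuppD_le _ _) _; rewrite fsubUset sy andbT.
  exact: fsubset_trans (msuppZ_le _ _) sx.
rewrite (lextEw f sx) (lextEw f sy) (lextEw f sxy) scaler_sumr -big_split /=.
by apply: eq_bigr => g _; rewrite mcoeffD mcoeffZ scalerDl scalerA.
Qed.

HB.instance Definition _ f :=
  GRing.isLinear.Build F {malg F[K]} V *:%R (lext f) (lext_is_linear f).

Lemma lextU f g : lext f << g >> = f g.
Proof. by rewrite /lext msuppU oner_eq0 big_seq_fset1 mcoeffUU scale1r. Qed.

End LinearExtension.

Lemma malg_sumU (K : choiceType) (F : comNzRingType) (x : {malg F[K]}) :
  x = \sum_(g <- msupp x) x@_g *: << g >>.
Proof.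
rewrite {1}[x]monalgE; apply: eq_bigr => g _; apply/malgP => k.
by rewrite mcoeffZ !mcoeffU mulr_natr.
Qed.

Lemma msupp_linear (K : choiceType) (F : comNzRingType)
    (f : {linear {malg F[K]} -> {malg F[K]}}) (y : {malg F[K]}) (k : K) :
  k \in msupp (f y) -> exists2 h, h \in msupp y & k \in msupp (f (<< h >>)).
Proof.
rewrite -mcoeff_neq0 => k0; apply: contrapT => nex; case/negP: k0; apply/eqP.
rewrite {1}[y]malg_sumU linear_sum raddf_sum big1_seq //= => h hy.
rewrite linearZ /= mcoeffZ [X in _ * X](_ : _ = 0) ?mulr0 //.
by apply/mcoeff_outdom/negP => kh; apply: nex; exists h.
Qed.

Lemma mcoeff_comb (K : choiceType) (F : comNzRingType) (x y : {malg F[K]})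
    (u v : F) k : (u *: x + v *: y)@_k = u * x@_k + v * y@_k.
Proof. by rewrite mcoeffD !mcoeffZ. Qed.

Lemma bilinear_expand (F : comNzRingType) (V : lmodType F) (B : V -> V -> V)
    (m : V -> F) (Bl : forall y, linear (B ^~ y)) (Br : forall x, linear (B x))
    (mlin : forall c x y, m (c *: x + y) = c * m x + m y)
    (u v u' v' : F) (x1 x2 y1 y2 : V) :
  m (B (u *: x1 + v *: x2) (u' *: y1 + v' *: y2)) =
    u * (u' * m (B x1 y1) + v' * m (B x1 y2)) +
    v * (u' * m (B x2 y1) + v' * m (B x2 y2)).
Proof.
have m0 : m 0 = 0 by have := mlin (-1) 0 0; rewrite scaler0 addr0 mulN1r addNr.
have mZ c x : m (c *: x) = c * m x by rewrite -[c *: x]addr0 mlin m0 addr0.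
have BZ x c y : B x (c *: y) = c *: B x y.
  have B0 : B x 0 = 0 by have := Br x (-1) 0 0;
    rewrite scaler0 addr0 scaleN1r addNr.
  by rewrite -[c *: y]addr0 Br B0 addr0.
have BDZ x2' y c : B (c *: x2') y = c *: B x2' y.
  have B0 : B 0 y = 0 by have := Bl y (-1) 0 0;
    rewrite /= scaler0 addr0 scaleN1r addNr.
  by rewrite -[c *: x2']addr0 (Bl y) /= B0 addr0.
by rewrite (Bl _) /= mlin !BDZ mZ !Br !BZ !mlin !mZ.
Qed.

Lemma bilinear_sum (F : comNzRingType) (V : lmodType F) (B : V -> V -> V)
    (Bl : forall y, linear (B ^~ y)) (Br : forall x, linear (B x))
    (I J : Type) (r : seq I) (s : seq J) (c : I -> F) (d : J -> F)
    (e : I -> V) (f : J -> V) :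
  B (\sum_(i <- r) c i *: e i) (\sum_(j <- s) d j *: f j) =
  \sum_(i <- r) \sum_(j <- s) (c i * d j) *: B (e i) (f j).
Proof.
have B0l y : B 0 y = 0.
  by have := Bl y (-1) 0 0; rewrite /= scaler0 addr0 scaleN1r addNr.
have B0r x : B x 0 = 0.
  by have := Br x (-1) 0 0; rewrite scaler0 addr0 scaleN1r addNr.
elim: r => [|i r IH]; first by rewrite !big_nil B0l.
rewrite !big_cons (Bl _) /= IH; congr (_ + _); elim: s {IH} => [|j s IH].
  by rewrite !big_nil B0r scaler0.
by rewrite !big_cons Br scalerDr IH scalerA.
Qed.

(** In use the four terms pair [dag g] and [g] with [dag h] and [h] at one monomial. Weights kill
    the first two; the third vanishes as well, unless [h] is self-adjoint and it merges with the
    fourth. *)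
Lemma surviving_pairing_term (F : fieldType) (u v u' v' p q s t : F) :
    p = 0 -> q = 0 -> s = 0 \/ s = t /\ u' + v' != 0 -> v != 0 -> v' != 0 ->
  t != 0 -> u * (u' * p + v' * q) + v * (u' * s + v' * t) != 0.
Proof.
move=> -> -> [->|[-> uv']] v0 v'0 t0; rewrite !mulr0 !add0r ?mulr0 ?add0r.
  by rewrite !mulf_neq0.
by rewrite -mulrDl !mulf_neq0.
Qed.

(** * The Weyl algebra over a numeric field *)

Definition dag (n : nat) (g : mono n) : mono n := (g.2, g.1).

Lemma dagK n : involutive (@dag n). Proof. by case. Qed.

(* The operations of Defs over an abstract field and locked: over R[i] they are
   transparent enough for unification to diverge. *)
HB.lock Definition amonF (F : numFieldType) n (g : mono n) : {malg F[mono n]} :=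
  << (1 : F) *g g >>.

HB.lock Definition mono_mulF (F : numFieldType) n (g h : mono n) :
    {malg F[mono n]} :=
  \sum_(k : {ffun 'I_n -> 'I_((\sum_(j < n) g.2 j)%N.+1)})
     << ((\prod_(j < n) ('C(g.2 j, k j) * 'C(h.1 j, k j) * (k j)`!))%N)%:R
        *g ([ffun j => g.1 j + h.1 j - k j]%N,
            [ffun j => g.2 j + h.2 j - k j]%N) >>.

HB.lock Definition wmulF (F : numFieldType) n (x y : {malg F[mono n]}) :
    {malg F[mono n]} :=
  lext (fun g => lext (mono_mulF F g) y) x.

HB.lock Definition wbrF (F : numFieldType) n (x y : {malg F[mono n]}) :
    {malg F[mono n]} :=
  wmulF x y - wmulF y x.

HB.lock Definition wdagF (F : numFieldType) n (cj : F -> F)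
    (x : {malg F[mono n]}) : {malg F[mono n]} :=
  \sum_(g <- msupp x) << cj x@_g *g dag g >>.

HB.lock Definition gsigF (F : numFieldType) n (cj : F -> F) (im : F)
    (sigma : bool) (g : mono n) : {malg F[mono n]} :=
  if sigma then im *: (wdagF cj (amonF F g) + amonF F g)
  else wdagF cj (amonF F g) - amonF F g.

Section WeylAlgebra.
Context (F : numFieldType) (n : nat).
Local Notation mono := (mono n).
Local Notation weyl := {malg F[mono]}.
Implicit Types (g h mu : mono) (x y z : weyl) (c u v : F).
Local Notation amonF := (@amonF F n).
Local Notation mono_mulF := (@mono_mulF F n).
Local Notation wmulF := (@wmulF F n).
Local Notation wbrF := (@wbrF F n).

Lemma mcoeff_amon g mu : (amonF g)@_mu = (g == mu)%:R.
Proof. by rewrite amonF.unlock mcoeffU. Qed.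

Lemma lext_amon (V : lmodType F) (E : mono -> V) g : lext E (amonF g) = E g.
Proof. by rewrite amonF.unlock lextU. Qed.

Lemma sum_amon x : x = \sum_(g <- msupp x) x@_g *: amonF g.
Proof. by rewrite {1}[x]malg_sumU; apply: eq_bigr => g _;
  rewrite amonF.unlock. Qed.

Lemma wmul_linl y : linear (wmulF ^~ y).
Proof. by move=> c x z; rewrite wmulF.unlock linearP. Qed.

Lemma wmul_linr x : linear (wmulF x).
Proof.
move=> c y z; rewrite wmulF.unlock /lext scaler_sumr -big_split /=.
apply: eq_bigr => g _; rewrite -!/(lext _ _) linearP /=.
by rewrite scalerDr !scalerA mulrC.
Qed.

Lemma wmul_amon g h : wmulF (amonF g) (amonF h) = mono_mulF g h.
Proof. by rewrite wmulF.unlock !lext_amon. Qed.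

HB.instance Definition _ x := GRing.isLinear.Build F weyl weyl *:%R (wmulF x)
  (wmul_linr x).

Lemma wbr_linr x : linear (wbrF x).
Proof.
move=> c y z; rewrite wbrF.unlock wmul_linl wmul_linr scalerBr.
by rewrite opprD addrACA.
Qed.

HB.instance Definition _ x := GRing.isLinear.Build F weyl weyl *:%R (wbrF x)
  (wbr_linr x).

Lemma wbrC x y : wbrF x y = - wbrF y x.
Proof. by rewrite wbrF.unlock opprB. Qed.

Lemma wbr_linl y : linear (wbrF ^~ y).
Proof. by move=> c x z; rewrite ![wbrF _ y]wbrC linearP opprD scalerN. Qed.

Lemma wbrZl c x z : wbrF (c *: x) z = c *: wbrF x z.
Proof. by rewrite ![wbrF _ z]wbrC linearZ scalerN. Qed.

(* [cc g h k] is the coefficient of [a^(g + h - (k, k))] in [a^g a^h]. *)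
Definition cc g h (k : 'I_n -> nat) : nat :=
  (\prod_(j < n) ('C(g.2 j, k j) * 'C(h.1 j, k j) * (k j)`!))%N.

(** The contraction that the target [mu] forces. Subtraction on [nat] truncates, so [admissible]
    checks that it is the true difference in both halves of [mu]. *)
Definition kap g h mu (j : 'I_n) : nat := (g.1 j + h.1 j - mu.1 j)%N.

Definition admissible g h mu : bool :=
  [forall j, (mu.1 j + kap g h mu j == g.1 j + h.1 j)%N &&
             (mu.2 j + kap g h mu j == g.2 j + h.2 j)%N].

Lemma cc_neq0P g h k :
  reflect (forall j, k j <= g.2 j /\ k j <= h.1 j)%N (cc g h k != 0%N).
Proof.
rewrite /cc prod_nat_seq_eq0 -all_predC; apply: (iffP allP) => H j.
  have := H j (mem_index_enum j); rewrite /= -lt0n !muln_gt0 !bin_gt0 fact_gt0.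
  by rewrite andbT => /andP.
by move=> _; rewrite /= -lt0n !muln_gt0 !bin_gt0 fact_gt0 andbT; apply/andP.
Qed.

(** Contractions with nonzero coefficient yield distinct monomials, so at most the term k =
    [kap g h mu] contributes at [mu]. *)
Lemma mcoeff_mono_mul g h mu :
  (mono_mulF g h)@_mu = (admissible g h mu * cc g h (kap g h mu))%:R.
Proof.
rewrite mono_mulF.unlock raddf_sum /=; set K := (\sum_(j < n) g.2 j)%N.
under eq_bigr => k _ do
  rewrite mcoeffU -/(cc g h (fun j => nat_of_ord (k j))).
have contrib (k : {ffun 'I_n -> 'I_K.+1}) : cc g h (fun j => k j) != 0%N ->
    ([ffun j => (g.1 j + h.1 j - k j)%N], [ffun j => (g.2 j + h.2 j - k j)%N])
      == mu -> admissible g h mu /\ forall j, kap g h mu j = k j.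
  move=> /cc_neq0P c0 /eqP <-; split; last first.
    by move=> j; rewrite /kap /= ffunE; have := c0 j; lia.
  by apply/forallP => j; rewrite /kap /= !ffunE; have := c0 j; lia.
have ccext k l : k =1 l -> cc g h k = cc g h l.
  by move=> kl; apply: eq_bigr => j _; rewrite kl.
have [cc0|] := eqVneq (admissible g h mu * cc g h (kap g h mu))%N 0%N.
  rewrite cc0 big1 // => k _; case: (boolP (_ == mu)) => // mmE.
  rewrite mulr1n; have [-> //|c0] := eqVneq (cc g h (fun j => k j)) 0%N.
  have [adm kapE] := contrib k c0 mmE.
  by case/eqP: c0; rewrite -(ccext _ _ kapE) -[RHS]cc0 adm mul1n.
rewrite muln_eq0 negb_or eqb0 negbK => /andP[adm ck0]; rewrite adm mul1n.
have kapK j : (kap g h mu j < K.+1)%N.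
  have /cc_neq0P/(_ j)[le_kg _] := ck0.
  by rewrite ltnS (leq_trans le_kg) // /K (bigD1 j) //= leq_addr.
pose k0 := [ffun j => Ordinal (kapK j)].
have k0E j : k0 j = kap g h mu j :> nat by rewrite ffunE.
rewrite (bigD1 k0) //= big1 ?addr0 => [|k kk0].
  rewrite -(ccext _ _ k0E); set b := (_ == mu).
  suff -> : b by [].
  move/forallP: adm => adm; apply/eqP; rewrite [mu]surjective_pairing.
  by congr pair; apply/ffunP => j; rewrite !ffunE /=; have := adm j;
    rewrite /kap; lia.
case: (boolP (_ == mu)) => // mmE; have [-> //|c0] :=
  eqVneq (cc g h (fun j => k j)) 0%N.
have [_ kapE] := contrib k c0 mmE.
by case/eqP: kk0; apply/ffunP => j; apply: val_inj; rewrite /= k0E kapE.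
Qed.

Lemma kapC g h mu : kap g h mu = kap h g mu.
Proof. by apply/funext => j; rewrite /kap addnC. Qed.

Lemma admissibleC g h mu : admissible g h mu = admissible h g mu.
Proof.
rewrite /admissible; apply: eq_forallb => j.
by rewrite kapC addnC [(g.2 j + _)%N]addnC [(h.1 j + _)%N]addnC.
Qed.

Lemma mcoeff_wbr_amon g h mu :
  (wbrF (amonF g) (amonF h))@_mu =
  (admissible g h mu * cc g h (kap g h mu))%:R -
  (admissible g h mu * cc h g (kap g h mu))%:R.
Proof.
rewrite wbrF.unlock !wmul_amon mcoeffB !mcoeff_mono_mul.
by rewrite [admissible h g _]admissibleC [kap h g _]kapC.
Qed.

(** For the last clause: exchanging the factors does not change the contribution of a mode in which
    both are balanced. If every contracted mode were of this kind, the two orders would cancel. *)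
Lemma wbr_amon_supp g h mu : mu \in msupp (wbrF (amonF g) (amonF h)) ->
  exists k : 'I_n -> nat,
  [/\ forall j, (mu.1 j + k j = g.1 j + h.1 j)%N /\
                (mu.2 j + k j = g.2 j + h.2 j)%N,
      (forall j, k j <= g.2 j /\ k j <= h.1 j)%N \/
      (forall j, k j <= h.2 j /\ k j <= g.1 j)%N &
      exists2 j, (0 < k j)%N & ~~ ((g.1 j == g.2 j) && (h.1 j == h.2 j))].
Proof.
rewrite -mcoeff_neq0 mcoeff_wbr_amon.
case adm: (admissible g h mu); last by rewrite !mul0n subrr eqxx.
rewrite !mul1n subr_eq0 => ccN; exists (kap g h mu); split.
- by move=> j; have /forallP/(_ j)/andP[/eqP -> /eqP ->] := adm.
- have [c0|/cc_neq0P] := eqVneq (cc g h (kap g h mu)) 0%N; last by left.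
  by right; apply/cc_neq0P; apply: contraNneq ccN => ->; rewrite c0.
apply: contrapT => nex; case/negP: ccN; apply/eqP; congr (_%:R).
apply: eq_bigr => j _; have [->|kj] := posnP (kap g h mu j);
  first by rewrite !bin0.
have /negPn/andP[/eqP -> /eqP ->] : ~~ ~~ ((g.1 j == g.2 j) && (h.1 j == h.2
  j)).
  by apply/negP => d; apply: nex; exists j.
by congr (_ * _)%N; apply: mulnC.
Qed.

Lemma wbr_supp_r x y mu : mu \in msupp (wbrF x y) ->
  exists2 h, h \in msupp y & mu \in msupp (wbrF x (amonF h)).
Proof. by rewrite amonF.unlock; apply: (msupp_linear (f := wbrF x)). Qed.

Lemma wbr_supp x y mu : mu \in msupp (wbrF x y) ->
  exists g h, [/\ g \in msupp x, h \in msupp y &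
                  mu \in msupp (wbrF (amonF g) (amonF h))].
Proof.
move=> /wbr_supp_r[h hy]; rewrite wbrC msuppN => /wbr_supp_r[g gx].
by rewrite wbrC msuppN => mugh; exists g, h.
Qed.

(** The monomial left by contracting a single pair, in mode [i]. Its coefficient in the commutator
    is the mode-[i] term of the Poisson bracket. *)
Definition shift1 g h (i : 'I_n) : mono :=
  ([ffun j => g.1 j + h.1 j - (j == i)]%N, [ffun j =>
    g.2 j + h.2 j - (j == i)]%N).

Lemma mcoeff_shift1 g h i : (0 < g.1 i + h.1 i)%N -> (0 < g.2 i + h.2 i)%N ->
  (wbrF (amonF g) (amonF h))@_(shift1 g h i) =
  (g.2 i * h.1 i)%:R - (h.2 i * g.1 i)%:R.
Proof.
move=> gi hi.
have kE : kap g h (shift1 g h i) = fun j => (j == i) : nat.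
  by apply/funext => j; rewrite /kap /= ffunE; case: eqP => [->|_] /=; lia.
have adm : admissible g h (shift1 g h i).
  by apply/forallP => j; rewrite kE /= !ffunE;
    have [->|_] := eqVneq j i => /=; lia.
have ccE g' h' : cc g' h' (fun j => (j == i) : nat) = (g'.2 i * h'.1 i)%N.
  rewrite /cc (bigD1 i) //= eqxx !bin1 muln1 big1 ?muln1 // => j /negPf ->.
  by rewrite !bin0.
by rewrite mcoeff_wbr_amon adm kE !ccE !mul1n.
Qed.

Lemma mcoeff_shift1_neq0 g h i : g.1 i != g.2 i -> h.1 i = h.2 i ->
  (0 < h.1 i)%N -> (wbrF (amonF g) (amonF h))@_(shift1 g h i) != 0.
Proof.
move=> gi hi h0; rewrite mcoeff_shift1; [|lia|lia].
by rewrite subr_eq0 eqr_nat -hi mulnC eqn_pmul2l // eq_sym.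
Qed.

Lemma wbr_num_mono k g :
  wbrF (amonF (num_mono k)) (amonF g) = ((g.1 k)%:R - (g.2 k)%:R) *: amonF g.
Proof.
have shiftE : shift1 (num_mono k) g k = g.
  rewrite [RHS]surjective_pairing; congr pair; apply/ffunP => j;
    by rewrite !ffunE addKn.
apply/malgP => mu; rewrite mcoeffZ mcoeff_amon.
have [<-|gmu] := eqVneq g mu.
  have := @mcoeff_shift1 (num_mono k) g k; rewrite shiftE mulr1 => -> /=;
    by rewrite ?ffunE eqxx ?mul1n ?muln1.
rewrite mulr0; apply: mcoeff_outdom; apply: contra gmu => /wbr_amon_supp.
move=> [e [eE le_e [j ej _]]]; apply/eqP; rewrite -shiftE.
(* [num_mono k] has exponent 1 in mode [k] and 0 elsewhere, so a nonzero contraction can only be the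
   single one in mode [k]. *)
have eD i : e i = (i == k).
  have le1 i' : (e i' <= (i' == k))%N.
    by case: le_e => /(_ i') /=; rewrite !ffunE => -[].
  have jk : j = k by apply/eqP; have := le1 j; case: (j == k) => //; lia.
  by have := le1 i; have [->|//] := eqVneq i k; [rewrite -jk; lia|lia].
rewrite [RHS]surjective_pairing; congr pair; apply/ffunP => i;
  rewrite !ffunE /=;
  by have := eE i; rewrite eD /= !ffunE; move: (nat_of_bool (i == k)) => d; lia.
Qed.

(** A contraction removes one creation and one annihilation operator of the same mode, so weights
    add under products. *)
Lemma wbr_amon_out g h mu j :
  (mu.1 j + g.2 j + h.2 j != mu.2 j + g.1 j + h.1 j)%N ->
  (wbrF (amonF g) (amonF h))@_mu = 0.
Proof.
move=> muN; apply: mcoeff_outdom; apply: contra muN =>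
  /wbr_amon_supp[k [E _ _]].
by apply/eqP; have := E j; lia.
Qed.

(** In mode [i] the target has the weight of [g], which is nonzero; this excludes both terms with
    [dag g]. If [h] is not self-adjoint, another mode in which it has nonzero weight excludes
    [dag h]. *)
Lemma pairing_neq0 g h i u v u' v' : g.1 i != g.2 i -> h.1 i = h.2 i ->
    (0 < h.1 i)%N -> v != 0 -> v' != 0 -> (dag h = h -> u' + v' != 0) ->
  (wbrF (u *: amonF (dag g) + v *: amonF g)
       (u' *: amonF (dag h) + v' *: amonF h))@_(shift1 g h i) != 0.
Proof.
move=> gi hi h0 v0 v'0 uv0; have main := mcoeff_shift1_neq0 gi hi h0.
set mu := shift1 g h i in main *.
have zg h' j : (mu.1 j + g.1 j + h'.2 j != mu.2 j + g.2 j + h'.1 j)%N ->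
  (wbrF (amonF (dag g)) (amonF h'))@_mu = 0 by exact: (wbr_amon_out (g :=
    dag g)).
rewrite (bilinear_expand (m := mcoeff mu) wbr_linl wbr_linr);
  last by move=> *; rewrite mcoeffD mcoeffZ.
apply: surviving_pairing_term main => //.
- by apply: (zg _ i); rewrite /mu /= !ffunE eqxx /=; lia.
- by apply: (zg _ i); rewrite /mu /= !ffunE eqxx /=; lia.
have [hh|hh] := eqVneq (dag h) h; first by right; rewrite hh uv0.
have [j hj] : exists j, h.1 j != h.2 j.
  apply: contrapT => nex; case/eqP: hh.
  have hE : h.1 = h.2.
    by apply/ffunP => j; apply/eqP/negPn/negP => hj; case: nex; exists j.
  by rewrite [RHS]surjective_pairing /dag hE.
have ij : j != i by apply: contraNneq hj => ->; rewrite hi.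
left; apply: (wbr_amon_out (h := dag h) (j := j)).
by rewrite /mu /= !ffunE (negPf ij); lia.
Qed.

End WeylAlgebra.

(** * The adjoint and the elements g_+ and g_- *)

Section Dagger.
Context (F : numFieldType) (n : nat) (cj : {rmorphism F -> F}).
Local Notation mono := (mono n).
Local Notation weyl := {malg F[mono]}.
Implicit Types (g h mu : mono) (x y z : weyl) (c u v : F).

Local Notation wdagF := (@wdagF F n cj).

Lemma mcoeff_wdag x mu : (wdagF x)@_mu = cj x@_(dag mu).
Proof.
rewrite wdagF.unlock raddf_sum /=.
under eq_bigr => g _ do rewrite mcoeffU (can2_eq (@dagK n) (@dagK n)).
have [mx|mx] := boolP (dag mu \in msupp x).
  rewrite (big_fsetD1 (dag mu)) //= eqxx big1_fset ?addr0 // => g.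
  by rewrite in_fsetD1 => /andP[/negPf-> _].
rewrite (mcoeff_outdom mx) rmorph0 big1_fset // => g gx _.
by case: eqP gx mx => // -> ->.
Qed.

Lemma wdagD x y : wdagF (x + y) = wdagF x + wdagF y.
Proof.
apply/malgP => mu.
by rewrite mcoeff_wdag !mcoeffD !mcoeff_wdag rmorphD.
Qed.

Lemma wdagZ c x : wdagF (c *: x) = cj c *: wdagF x.
Proof.
by apply/malgP => mu; rewrite mcoeff_wdag !mcoeffZ mcoeff_wdag rmorphM.
Qed.

Lemma wdag_amon g : wdagF (amonF F g) = amonF F (dag g).
Proof.
apply/malgP => mu; rewrite mcoeff_wdag mcoeff_amon mcoeff_amon (can2_eq (@dagK
  n) (@dagK n)).
by rewrite rmorph_nat.
Qed.

Lemma wdag_sum (I : Type) (r : seq I) (E : I -> weyl) :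
  wdagF (\sum_(i <- r) E i) = \sum_(i <- r) wdagF (E i).
Proof.
apply: (big_morph _ wdagD).
by have := wdagZ 0 0; rewrite rmorph0 !scale0r.
Qed.

Lemma wdagN x : wdagF (- x) = - wdagF x.
Proof. by rewrite -!scaleN1r wdagZ rmorphN rmorph1. Qed.

Lemma wdag_mono_mul g h : wdagF (mono_mulF F g h) = mono_mulF F (dag h) (dag g).
Proof.
apply/malgP => mu; rewrite mcoeff_wdag !mcoeff_mono_mul.
rewrite rmorph_nat; congr (_%:R).
have kE : admissible g h (dag mu) -> kap g h (dag mu) = kap (dag h) (dag g) mu.
  move=> /forallP adm; apply/funext => j; have := adm j.
  by rewrite /kap /dag /=; lia.
have admE : admissible g h (dag mu) = admissible (dag h) (dag g) mu.
  by apply: eq_forallb => j; rewrite /kap /dag /=; lia.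
rewrite -admE; case adm: (admissible _ _ _) => //; rewrite !mul1n (kE adm).
by apply: eq_bigr => j _; congr (_ * _)%N; rewrite mulnC.
Qed.

Lemma wdag_wmul x y : wdagF (wmulF x y) = wmulF (wdagF y) (wdagF x).
Proof.
have expand := bilinear_sum (@wmul_linl F n) (@wmul_linr F n).
have dagsum z : wdagF z = \sum_(g <- msupp z) cj z@_g *: amonF F (dag g).
  by rewrite {1}[z]sum_amon wdag_sum; apply: eq_bigr => g _;
    rewrite wdagZ wdag_amon.
rewrite (dagsum x) (dagsum y) expand {1}[x]sum_amon {1}[y]sum_amon expand.
rewrite exchange_big /=.
rewrite wdag_sum; apply: eq_bigr => h _; rewrite wdag_sum;
  apply: eq_bigr => g _.
by rewrite wdagZ rmorphM mulrC !wmul_amon wdag_mono_mul.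
Qed.

Lemma wdag_wbr x y :
  wdagF x = - x -> wdagF y = - y -> wdagF (wbrF x y) = - wbrF x y.
Proof.
move=> xE yE; rewrite wbrF.unlock wdagD wdagN !wdag_wmul xE yE.
have NN z t : wmulF (- z) (- t) = wmulF z t.
  rewrite linearN /=; have := @wmul_linl F n t (-1) z 0.
  rewrite scaleN1r addr0 => ->; rewrite scaleN1r opprD opprK.
  by have := @wmul_linl F n t (-1) 0 0; rewrite scaleN1r addr0 oppr0 => ->;
    rewrite scaleN1r addNr oppr0 addr0.
by rewrite !NN opprB.
Qed.

Context (im : F) (im0 : im != 0) (cj_im : cj im = - im).
Local Notation gsigF := (@gsigF F n cj im).

(** Treats both signs at once. The last clause holds because a self-adjoint monomial indexes a basis
    element only with the plus sign, where both coefficients are [im]. *)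
Lemma gsigE sigma g : exists u v, [/\ u != 0, v != 0,
  gsigF sigma g = u *: amonF F (dag g) + v *: amonF F g &
  is_basis sigma g -> dag g = g -> u + v != 0].
Proof.
case: sigma; rewrite gsigF.unlock wdag_amon.
  exists im, im; split=> //; first by rewrite scalerDr.
  by move=> _ _; rewrite -mulr2n mulrn_eq0.
exists 1, (-1); split; rewrite ?oppr_eq0 ?oner_eq0 //.
  by rewrite scale1r scaleN1r.
by case=> k [_ +] /(congr1 fst) /= gE; rewrite gE ltnn.
Qed.

Lemma skew_gsig sigma g : wdagF (gsigF sigma g) = - gsigF sigma g.
Proof.
case: sigma; rewrite gsigF.unlock wdag_amon.
  by rewrite wdagZ wdagD !wdag_amon dagK addrC cj_im scaleNr.
by rewrite wdagD wdagN !wdag_amon dagK opprB addrC.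
Qed.

Lemma msupp_gsig sigma g mu :
  mu \in msupp (gsigF sigma g) -> mu = g \/ mu = dag g.
Proof.
have [u [v [_ _ -> _]]] := gsigE sigma g.
rewrite -mcoeff_neq0 mcoeff_comb mcoeff_amon mcoeff_amon.
have [<-|_] := eqVneq (dag g) mu; first by right.
by have [<-|_] := eqVneq g mu; [left|rewrite !mulr0 addr0 eqxx].
Qed.

Lemma gsig_msupp sigma g : is_basis sigma g -> g \in msupp (gsigF sigma g).
Proof.
have [u [v [u0 v0 -> uv]]] := gsigE sigma g => gb.
rewrite -mcoeff_neq0 mcoeff_comb mcoeff_amon mcoeff_amon eqxx mulr1.
by have [/(uv gb)|_] := eqVneq (dag g) g; rewrite ?mulr1 ?mulr0 ?add0r.
Qed.

(** The second membership is the first with [h] and [dag h] exchanged. Both are recorded because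
    either monomial alone may have weight zero in a further mode. *)
Lemma wbr_gsig_msupp sigma tau g h i : is_basis tau h ->
    g.1 i != g.2 i -> h.1 i = h.2 i -> (0 < h.1 i)%N ->
  shift1 g h i \in msupp (wbrF (gsigF sigma g) (gsigF tau h)) /\
  shift1 g (dag h) i \in msupp (wbrF (gsigF sigma g) (gsigF tau h)).
Proof.
have [u [v [u0 v0 -> uv]]] := gsigE sigma g.
have [u' [v' [u'0 v'0 E uv']]] := gsigE tau h => hb gi hi h0.
rewrite -!mcoeff_neq0; split.
  by rewrite E; apply: pairing_neq0 => // hh; apply: uv'.
have := @pairing_neq0 F n g (dag h) i u v v' u' gi (esym hi); rewrite dagK.
rewrite (etrans E (addrC _ _)); apply=> //; first by rewrite -hi.
by move=> hh; rewrite addrC uv'.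
Qed.

End Dagger.

(** * Falling factorials and finite differences *)

Section FallingFactorial.
Context (F : numFieldType).
Implicit Types (A B p : {poly F}) (y z : F).

Definition ffp (m : nat) : {poly F} := \prod_(i < m) ('X - (i%:R)%:P).

Lemma size_ffp m : size (ffp m) = m.+1.
Proof. by rewrite /ffp size_prod_XsubC /index_enum -enumT size_enum_ord. Qed.

Lemma ffp_neq0 m : ffp m != 0.
Proof. by rewrite -size_poly_eq0 size_ffp. Qed.

Lemma ffpSr m y : (ffp m.+1).[y] = (ffp m).[y] * (y - m%:R).
Proof. by rewrite /ffp big_ord_recr /= hornerM !hornerE. Qed.

Lemma ffpS1 m y : (ffp m.+1).[y + 1] = (y + 1) * (ffp m).[y].
Proof.
rewrite /ffp big_ord_recl /= hornerM !hornerE subr0 !horner_prod.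
congr (_ * _); apply: eq_bigr => i _; rewrite !hornerE /bump /= natrD.
by ring.
Qed.

Lemma ffp_shift m y : (ffp m).[y + 1] = (ffp m).[y] + m%:R * (ffp m.-1).[y].
Proof.
case: m => [|m]; first by rewrite /ffp !big_ord0 !hornerE ?mul0r ?addr0.
by rewrite ffpS1 ffpSr /= -natr1; ring.
Qed.

Lemma ffpD m k y : (ffp (m + k)).[y] = (ffp m).[y] * (ffp k).[y - m%:R].
Proof.
elim: k => [|k IH]; first by rewrite addn0 {3}/ffp big_ord0 hornerE mulr1.
by rewrite addnS !ffpSr IH natrD opprD addrA mulrA.
Qed.

(** Vandermonde's identity by induction on [a], from [ffp_shift] and Pascal's rule for falling
    factorials. Terms with k > b vanish, so [K] can be chosen as one range for all modes. *)
Lemma ffp_vandermonde K b a y : (b <= K)%N ->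
  (ffp b).[y + a%:R] =
  \sum_(k < K.+1) ('C(b, k) * a ^_ k)%:R * (ffp (b - k)).[y].
Proof.
move=> bK; elim: a y => [|a IH] y.
  rewrite addr0 big_ord_recl big1 ?addr0 => [|i _].
    by rewrite bin0 ffactn0 subn0 mul1r.
  by rewrite ffact0n muln0 mul0r.
rewrite -natr1 [a%:R + 1]addrC addrA IH.
under eq_bigr => k _ do rewrite ffp_shift mulrDr.
rewrite big_split /= [X in _ + X]big_ord_recr /=.
have -> : ('C(b, K) * a ^_ K)%:R * ((b - K)%:R * (ffp (b - K).-1).[y]) = 0 :> F.
  by have /eqP -> : (b - K == 0)%N by []; rewrite mul0r mulr0.
rewrite addr0 big_ord_recl [RHS]big_ord_recl -addrA; congr (_ + _).
rewrite -big_split /=; apply: eq_bigr => k _; rewrite /bump /= add1n.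
have -> : (b - k).-1 = (b - k.+1)%N by lia.
rewrite mulrA -mulrDl -!natrM -natrD; congr (_%:R * _).
have ffS : (a.+1 ^_ k.+1 = a ^_ k.+1 + k.+1 * a ^_ k)%N.
  rewrite ffactSS ffactnSr; have [ka|ak] := leqP k a; first by nia.
  by rewrite ffact_small // !muln0.
by rewrite ffS mulnDr; congr (_ + _)%N; have := mul_bin_left b k; nia.
Qed.

(** Normal ordering in one mode, read off from the factors on powers of z: the sum is the reordered
    product, the right-hand side the composition of the two actions. *)
Lemma ffp_normal_order K b a' b' z : (b <= K)%N ->
  \sum_(k < K.+1) ('C(b, k) * 'C(a', k) * k`!)%:R * (ffp (b + b' - k)).[z] =
  (ffp b').[z] * (ffp b).[z + (a'%:R - b'%:R)].
Proof.
move=> bK; have -> : z + (a'%:R - b'%:R) = (z - b'%:R) + a'%:R by ring.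
rewrite (ffp_vandermonde _ _ bK) mulr_sumr.
apply: eq_bigr => k _; rewrite -mulnA bin_ffact.
have [kb|bk] := leqP k b; last first.
  by rewrite bin_small // mul0n !mul0r mulr0.
by rewrite -addnBAC // addnC ffpD mulrCA.
Qed.

Lemma poly_eq0_everywhere p : (forall t, p.[t] = 0) -> p = 0.
Proof.
move=> p0; apply/eqP/negPn/negP => pN0.
have /(max_poly_roots pN0) : all (root p) [seq i%:R | i <- iota 0 (size p)].
  by apply/allP => x _; apply/eqP.
rewrite map_inj_uniq ?iota_uniq; last by move=> i j /eqP;
  rewrite eqr_nat => /eqP.
by rewrite size_map size_iota ltnn => /(_ isT).
Qed.

Definition fdiff A := A \Po ('X + 1%:P) - A.

Lemma fdiffE A t : (fdiff A).[t] = A.[t + 1] - A.[t].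
Proof. by rewrite /fdiff hornerD hornerN horner_comp !hornerE. Qed.

(** Induction along A = p X + c, where the difference of A is (fdiff p) X + fdiff p + p. *)
Lemma fdiff_lead m A : (size A <= m.+1)%N ->
  (size (fdiff A) <= m)%N /\ (fdiff A)`_m.-1 = m%:R * A`_m.
Proof.
elim: m A => [|m IH] A sA.
  have -> : fdiff A = 0 by rewrite (size1_polyC sA) /fdiff comp_polyC subrr.
  by rewrite size_poly0 coef0 mul0r.
elim/poly_ind: A sA => [|p c _] sA.
  by rewrite /fdiff comp_poly0 subrr size_poly0 !coef0 mulr0.
have sp : (size p <= m.+1)%N.
  have [->|p0] := eqVneq p 0; first by rewrite size_poly0.
  by move: sA; rewrite size_MXaddC (negPf p0).
have [s_dp c_dp] := IH p sp.
have E : fdiff (p * 'X + c%:P) = fdiff p * 'X + (fdiff p + p).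
  rewrite /fdiff comp_polyD comp_polyM comp_polyX comp_polyC.
  by rewrite polyC1; ring.
rewrite E; move: (fdiff p) s_dp c_dp {E} => D s_dp c_dp; split.
  rewrite (leq_trans (size_polyD _ _)) // geq_max; apply/andP; split.
    by rewrite (leq_trans (size_polyMleq _ _)) // size_polyX addn2.
  by rewrite (leq_trans (size_polyD _ _)) // geq_max sp (leq_trans s_dp).
rewrite /= !coefD !coefMX coefC /= addr0.
rewrite (nth_default 0 s_dp) add0r -[m.+1%:R]natr1 mulrDl mul1r.
by case: (m) c_dp => [|k] /= c_dp; rewrite ?c_dp // mul0r.
Qed.

Lemma size_fdiff A : (1 < size A)%N -> size (fdiff A) = (size A).-1.
Proof.
case sA: (size A) => [|[|m]] // _.
have [le_s lead] := @fdiff_lead m.+1 A (eq_leq sA).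
apply/eqP; rewrite eqn_leq le_s ltnNge; apply/negP =>
  /leq_sizeP/(_ m (leqnn m)).
move/eqP; rewrite lead mulf_eq0 pnatr_eq0 /= => /eqP A0.
have : lead_coef A = 0 by rewrite lead_coefE sA.
by move/eqP; rewrite lead_coef_eq0 -size_poly_eq0 sA.
Qed.

End FallingFactorial.

(** * The action on Laurent monomials *)

Section Representation.
Context (F : numFieldType) (n : nat).
Local Notation mono := (mono n).
Local Notation weyl := {malg F[mono]}.
Local Notation pt := ('I_n -> F).
Implicit Types (g h : mono) (x y z : weyl) (r v w : pt) (phi : pt -> F).

Definition FF (b : 'I_n -> nat) r : F := \prod_j (ffp F (b j)).[r j].

Definition wt g : pt := fun j => (g.1 j)%:R - (g.2 j)%:R.

Definition trans w r : pt := fun j => r j + w j.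

(* The transpose of the action of A_n on the Laurent monomials z^r, with
   [a_j = d/dz_j] and [a_j^+ = z_j]; [phi] is a linear form on their span and
   exponents are allowed in F, so that no boundary terms occur. *)
Definition act x phi r : F :=
  lext (fun g => (FF g.2 r * phi (trans (wt g) r) : F^o)) x.

Lemma act_sum (I : Type) (s : seq I) (P : pred I) (c : I -> F) (X : I ->
  weyl) phi r :
  act (\sum_(i <- s | P i) c i *: X i) phi r = \sum_(i <- s | P i) c i * act (X
    i) phi r.
Proof. by rewrite /act linear_sum; apply: eq_bigr => i _; rewrite linearZ. Qed.

Lemma actZ c x phi r : act (c *: x) phi r = c * act x phi r.
Proof. by rewrite /act linearZ. Qed.

Lemma actB x y phi r : act (x - y) phi r = act x phi r - act y phi r.
Proof. by rewrite /act linearB. Qed.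

Lemma act_amon g phi r : act (amonF F g) phi r = FF g.2 r * phi (trans (wt g)
  r).
Proof. by rewrite /act lext_amon. Qed.

Lemma actE x phi r :
  act x phi r = \sum_(g <- msupp x) x@_g * (FF g.2 r * phi (trans (wt g) r)).
Proof. by []. Qed.

(** The order of composition is reversed because [act] is a transpose. The sum over contractions
    factors into one sum per mode, each given by [ffp_normal_order]. *)
Lemma act_mono_mul g h phi r :
  act (mono_mulF F g h) phi r = act (amonF F h) (act (amonF F g) phi) r.
Proof.
rewrite !act_amon mono_mulF.unlock; set K := (\sum_(j < n) g.2 j)%N.
pose mm (k : {ffun 'I_n -> 'I_K.+1}) : mono :=
  ([ffun j => (g.1 j + h.1 j - k j)%N], [ffun j => (g.2 j + h.2 j - k j)%N]).
have scale1 c (m : mono) : << c *g m >> = c *: amonF F m.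
  by apply/malgP => mu; rewrite mcoeffZ mcoeff_amon mcoeffU mulr_natr.
under eq_bigr => k _ do rewrite scale1.
rewrite act_sum; under eq_bigr => k _ do rewrite act_amon.
have term (k : {ffun 'I_n -> 'I_K.+1}) : (\prod_j ('C(g.2 j, k j) * 'C(h.1 j,
  k j) * (k j)`!))%N%:R *
    (FF (mm k).2 r * phi (trans (wt (mm k)) r)) =
  (\prod_j (('C(g.2 j, k j) * 'C(h.1 j, k j) * (k j)`!)%:R *
     (ffp F (g.2 j + h.2 j - k j)).[r j])) * phi (trans (wt g) (trans (wt h)
       r)).
  (* If a contraction exceeds the available exponents both sides vanish; otherwise the truncated
     subtractions are exact and the weights add. *)
  have [c0|] := eqVneq (cc g h (fun j => k j)) 0%N.
    rewrite -/(cc g h (fun j => nat_of_ord (k j))) c0 mul0r big_split /=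
      -natr_prod.
    by rewrite -/(cc g h (fun j => nat_of_ord (k j))) c0 !mul0r.
  move=> /cc_neq0P c0; rewrite natr_prod mulrA /FF -big_split /=;
    congr (_ * phi _).
    by apply: eq_bigr => j _; rewrite ffunE.
  apply/funext => j; rewrite /trans /wt /= !ffunE !natrB ?natrD; first by ring.
    by have := c0 j; lia.
  by have := c0 j; lia.
rewrite (eq_bigr _ (fun k _ => term k)) -mulr_suml mulrA; congr (_ * _).
rewrite -(bigA_distr_bigA (fun j (k : 'I_K.+1) =>
  ('C(g.2 j, k) * 'C(h.1 j, k) * k`!)%:R * (ffp F (g.2 j + h.2 j - k)).[r j])).
rewrite /FF -big_split /=; apply: eq_bigr => j _.
by rewrite ffp_normal_order // /K (bigD1 j) //= leq_addr.
Qed.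

Lemma act_wmul x y phi r : act (wmulF x y) phi r = act y (act x phi) r.
Proof.
have expand := bilinear_sum (@wmul_linl F n) (@wmul_linr F n).
rewrite {1}[x]sum_amon {1}[y]sum_amon expand exchange_big [RHS]actE /=.
have -> : act (\sum_(h <- msupp y) \sum_(g <- msupp x)
      (x@_g * y@_h) *: wmulF (amonF F g) (amonF F h)) phi r =
    \sum_(h <- msupp y) act (\sum_(g <- msupp x)
      (x@_g * y@_h) *: wmulF (amonF F g) (amonF F h)) phi r.
  by rewrite /act linear_sum.
apply: eq_bigr => h _; rewrite act_sum actE !mulr_sumr.
apply: eq_bigr => g _; rewrite wmul_amon act_mono_mul !act_amon.
by ring.
Qed.

End Representation.

(** * Finite-dimensional Lie algebras *)

Section FiniteDimensional.
Context (F : numFieldType) (n : nat).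
Local Notation mono := (mono n).
Local Notation weyl := {malg F[mono]}.
Local Notation pt := ('I_n -> F).
Implicit Types (g h : mono) (x y z p : weyl) (r v w : pt) (phi X Y P : pt -> F).

(** The spanning elements [s i] may lie outside [M]; the bound serves to make any [N + 1] elements
    of [M] dependent. *)
Record findim_lie (M : weyl -> Prop) : Prop := FindimLie {
  findim_comb : forall c x y, M x -> M y -> M (c *: x + y);
  findim_br : forall x y, M x -> M y -> M (wbrF x y);
  findim_span : exists (N : nat) (s : 'I_N -> weyl), forall x, M x ->
    exists c : 'I_N -> F, x = \sum_i c i *: s i }.

Definition homog x w X := forall phi r, act x phi r = X r * phi (trans w r).
Definition diagonal p P := forall phi r, act p phi r = P r * phi r.

Lemma homog_amon g : homog (amonF F g) (wt F g) (FF g.2).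
Proof. by move=> phi r; rewrite act_amon. Qed.

Lemma homog_wbr x w X p P : diagonal p P -> homog x w X ->
  homog (wbrF p x) w (fun r => (P (trans w r) - P r) * X r).
Proof.
move=> pP xX phi r; rewrite wbrF.unlock actB !act_wmul xX !pP xX; ring.
Qed.

Lemma diagonal_wbr x y w w' X Y : (forall j, w' j = - w j) ->
    homog x w X -> homog y w' Y ->
  diagonal (wbrF x y) (fun r => X (trans w' r) * Y r - X r * Y (trans w r)).
Proof.
move=> ww xX yY phi r; rewrite wbrF.unlock actB !act_wmul !xX !yY !xX.
have -> : trans w (trans w' r) = r.
  by apply/funext => j; rewrite /trans ww subrK.
have -> : trans w' (trans w r) = r.
  by apply/funext => j; rewrite /trans ww addrK.
by ring.
Qed.

Lemma left_kernel N (A : 'M[F]_(N.+1, N)) : exists2 u : 'rV_N.+1,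
  u != 0 & u *m A = 0.
Proof.
have kA0 : kermx A != 0.
  by rewrite -mxrank_eq0 mxrank_ker -lt0n subn_gt0 ltnS rank_leq_col.
exists (nz_row (kermx A)); first by rewrite nz_row_eq0.
by apply/sub_kermxP/nz_row_sub.
Qed.

(** Along the line t v the k-fold bracket of [p] with [x] has the factor Q^k Y. A relation among the
    first [N + 1] of these gives U(Q) Y = 0 with U nonzero, which is impossible for nonconstant
    Q. *)
Lemma findim_no_growth M x p w X P v (Q Y : {poly F}) : findim_lie M ->
    M x -> M p -> homog x w X -> diagonal p P ->
    (forall t, P (trans w (fun j => t * v j)) - P (fun j => t * v j) = Q.[t]) ->
    (forall t, X (fun j => t * v j) = Y.[t]) ->
  Y != 0 -> ~~ (1 < size Q)%N.
Proof.
move=> [Mcomb Mbr [N [s Ms]]] Mx Mp xX pP QE YE Y0; apply/negP => sQ.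
have iter k : exists2 z, M z &
    homog z w (fun r => (P (trans w r) - P r) ^+ k * X r).
  elim: k => [|k [z Mz zX]].
    by exists x => // phi r; rewrite expr0 mul1r.
  exists (wbrF p z); first exact: Mbr.
  by move=> phi r; rewrite (homog_wbr pP zX) exprS mulrA.
have [f fP] := choice (fun k => let: ex_intro2 z Mz zX := iter k in
  ex_intro (fun z => M z /\ homog z w (fun r =>
    (P (trans w r) - P r) ^+ k * X r))
    z (conj Mz zX)).
have [c cP] := choice (fun k => Ms (f k) (fP k).1).
have [u u0 uA] := left_kernel (\matrix_(k < N.+1, i < N) c k i).
case/eqP: u0.
have sum0 : \sum_(k < N.+1) u 0 k *: f k = 0.
  under eq_bigr => k _ do rewrite cP scaler_sumr.
  rewrite exchange_big big1 //= => i _.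
  have := congr1 (fun B : 'rV_N => B 0 i) uA; rewrite !mxE => uA0.
  rewrite -[RHS](scale0r (s i)) -{}uA0 scaler_suml.
  by apply: eq_bigr => k _; rewrite mxE scalerA.
pose U := \poly_(k < N.+1) u 0 (inord k).
have UQ : (U \Po Q) * Y = 0.
  apply: poly_eq0_everywhere => t; rewrite hornerM horner_comp.
  (* On the constant functional 1 the translation by [w] disappears and only the polynomial factors
     remain. *)
  have := congr1 (fun z => act z (fun=> 1) (fun j => t * v j)) sum0.
  rewrite act_sum [X in _ = X](_ : _ = 0); last first.
    by rewrite -(scale0r 0) actZ mul0r.
  move=> <-; rewrite /U horner_poly mulr_suml; apply: eq_bigr => k _.
  by rewrite (fP k).2 QE YE mulr1 inord_val mulrA.
have : U == 0.
  by rewrite -(comp_poly_eq0 _ sQ); move/eqP: UQ;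
    rewrite mulf_eq0 (negPf Y0) orbF.
move=> /eqP U0; apply/rowP => k; rewrite mxE.
by have := congr1 (fun B : {poly F} => B`_k) U0;
  rewrite coef_poly ltn_ord inord_val coef0.
Qed.

Lemma prod_poly_size (I : finType) (P : pred I) (E : I -> {poly F}) :
    (forall i, E i != 0) ->
  \prod_(i | P i) E i != 0 /\
  size (\prod_(i | P i) E i) = (\sum_(i | P i) (size (E i)).-1).+1.
Proof.
move=> E0; elim/big_rec2: _ => [|i m q _ [q0 sq]].
  by rewrite oner_eq0 size_poly1.
rewrite mulf_neq0 // size_mul // sq; split=> //.
have := E0 i; rewrite -size_poly_gt0.
by case: (size (E i)) => // k _; rewrite addSn addnS.
Qed.

Lemma size_comp_scaleX (E : {poly F}) c : c != 0 ->
  size (E \Po (c *: 'X)) = size E.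
Proof. by move=> c0; rewrite size_comp_poly2 // size_scale // size_polyX. Qed.

Section Line.
Context (E : 'I_n -> {poly F}) (w : pt).
Context (E0 : forall j, E j != 0).

(* Along this direction the derivative along w of a monomial of the leading
   form is a positive multiple of that monomial, hence does not vanish. *)
Definition direction : pt := fun j => if w j == 0 then 1 else w j.

(** On the line of [direction], translation by [w] becomes the shift of t by 1 in this factor and
    leaves [still] unchanged. *)
Definition moving : {poly F} := \prod_(j | w j != 0) (E j \Po (w j *: 'X)).
Definition still : {poly F} := \prod_(j | w j == 0) E j.

Lemma prod_on_line t u :
  \prod_j (E j).[t * direction j + u * w j] = moving.[t + u] * still.[t].
Proof.
rewrite (bigID (fun j => w j != 0)) /= !horner_prod; congr (_ * _).
  apply: eq_bigr => j /negPf wj; rewrite horner_comp !hornerE /direction wj.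
  by congr (_.[_]); ring.
rewrite (eq_bigl (fun j => w j == 0)); last by move=> j; rewrite negbK.
by apply: eq_bigr => j wj; rewrite /direction wj (eqP wj) mulr0 addr0 mulr1.
Qed.

Lemma size_moving : size moving = (\sum_(j | w j != 0) (size (E j)).-1).+1.
Proof.
have E'0 j : (if w j == 0 then 1 else E j \Po (w j *: 'X)) != 0.
  case: ifPn => [_|wj]; first exact: oner_neq0.
  by rewrite -size_poly_gt0 size_comp_scaleX // size_poly_gt0.
have [_] := prod_poly_size (fun j => w j != 0) E'0.
rewrite (eq_bigr (fun j => E j \Po (w j *: 'X))) => [->|j /negPf -> //].
by congr _.+1; apply: eq_bigr => j wj; rewrite (negPf wj) size_comp_scaleX.
Qed.

Lemma size_still : size still = (\sum_(j | w j == 0) (size (E j)).-1).+1.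
Proof. by have [_ ->] := prod_poly_size (fun j => w j == 0) E0. Qed.

Lemma still_neq0 : still != 0.
Proof. by have [] := prod_poly_size (fun j => w j == 0) E0. Qed.

End Line.

Lemma FF_on_line g w t : FF g.2 (fun j => t * direction w j) =
  (\prod_j (ffp F (g.2 j) \Po (direction w j *: 'X))).[t].
Proof.
rewrite horner_prod; apply: eq_bigr => j _.
by rewrite horner_comp !hornerE mulrC.
Qed.

Lemma FF_line_neq0 g w : \prod_j (ffp F (g.2 j) \Po (direction w j *: 'X)) != 0.
Proof.
apply/prodf_neq0 => j _; rewrite -size_poly_gt0 size_comp_scaleX ?size_ffp //.
by rewrite /direction; case: ifPn => // _; apply: oner_neq0.
Qed.

(** Here Q is a first difference of the moving factor, times the still one. Mode [i] makes the
    moving factor nonconstant, so Q has degree exactly one less than the product of the [E j], hence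
    at least one. *)
Lemma product_growth M p g (c : F) (E : 'I_n -> {poly F}) i : findim_lie M ->
    M p -> M (amonF F g) -> c != 0 -> (forall j, E j != 0) ->
    diagonal p (fun r => c * \prod_j (E j).[r j]) ->
    wt F g i != 0 -> (1 < size (E i))%N -> (1 < \sum_j (size (E j)).-1)%N ->
  False.
Proof.
move=> Mfd Mp Mg c0 E0 pE wi sEi sE; set w := wt F g in wi.
pose Q := c *: (fdiff (moving E w) * still E w).
have := findim_no_growth (v := direction w) (Q := Q) Mfd Mg Mp
  (homog_amon g) pE _ (FF_on_line g w) (FF_line_neq0 g w).
move=> /(_ _)/negP; apply.
  move=> t; rewrite /Q hornerZ hornerM fdiffE -mulrBr; congr (_ * _).
  have := prod_on_line E w t 1; have := prod_on_line E w t 0.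
  rewrite addr0 mulrBl => <- <-; rewrite /trans; congr (_ - _).
    by apply: eq_bigr => j _; rewrite mul1r.
  by apply: eq_bigr => j _; rewrite mul0r addr0.
have sA : (1 < size (moving E w))%N.
  by rewrite size_moving // (bigD1 i) //=; case: (size (E i)) sEi => [|[]].
have D0 : fdiff (moving E w) != 0.
  by rewrite -size_poly_gt0 size_fdiff //; case: (size (moving E w)) sA =>
    [|[]].
rewrite /Q size_scale // size_mul ?still_neq0 // size_fdiff //.
rewrite size_moving // size_still //=.
move: sE; rewrite (bigID (fun j => w j != 0)) /=.
rewrite [X in (_ < _ + X)%N](eq_bigl (fun j => w j == 0)) => [|j];
  last by rewrite negbK.
by rewrite addnS.
Qed.

(* [prod_j (normF g j).[r j]] is the eigenvalue of (a^g)^+ a^g on z^r. *)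
Definition normF g (j : 'I_n) : {poly F} :=
  ffp F (g.2 j) * (ffp F (g.1 j) \Po ('X + (wt F g j)%:P)).

Lemma size_normF g j : size (normF g j) = (g.1 j + g.2 j).+1.
Proof.
have s1 : size (ffp F (g.1 j) \Po ('X + (wt F g j)%:P)) = (g.1 j).+1.
  by rewrite size_comp_poly2 ?size_XaddC // size_ffp.
have c0 : ffp F (g.1 j) \Po ('X + (wt F g j)%:P) != 0.
  by rewrite -size_poly_gt0 s1.
by rewrite /normF size_mul ?ffp_neq0 // s1 size_ffp addSn addnS addnC.
Qed.

Lemma diagonal_norm g : diagonal (wbrF (amonF F g) (amonF F (dag g)))
  (fun r => \prod_j (normF g j).[r j - wt F g j] - \prod_j (normF g j).[r j]).
Proof.
have wd j : wt F (dag g) j = - wt F g j by rewrite /wt opprB.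
move=> phi r; rewrite (diagonal_wbr wd (homog_amon g) (homog_amon (dag g))).
congr ((_ - _) * _); rewrite /FF -big_split /=; apply: eq_bigr => j _.
  by rewrite /normF hornerM horner_comp hornerD hornerX hornerC subrK /trans wd.
by rewrite /normF hornerM horner_comp hornerD hornerX hornerC.
Qed.

(** Q is minus a central second difference of the moving factor, times the still one. The first
    bound makes the moving factor at least quadratic, so Q has degree |g| - 2, positive by the
    second bound. *)
Lemma norm_growth M g : findim_lie M -> M (amonF F g) -> M (amonF F (dag g)) ->
    (1 < \sum_(j | g.1 j != g.2 j) (g.1 j + g.2 j))%N -> (2 < Defs.mdeg g)%N ->
  False.
Proof.
move=> Mfd Mg Mdg e2 d3; set w := wt F g.
have w0E j : (w j == 0) = (g.1 j == g.2 j) by rewrite subr_eq0 eqr_nat.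
set A := moving (normF g) w; set B := still (normF g) w.
have N0 j : normF g j != 0 by rewrite -size_poly_gt0 size_normF.
pose Q := - ((fdiff (fdiff A) \Po ('X - 1%:P)) * B).
have := findim_no_growth (v := direction w) (Q := Q) Mfd Mg
  (findim_br Mfd Mg Mdg) (homog_amon g) (diagonal_norm g) _
  (FF_on_line g w) (FF_line_neq0 g w).
move=> /(_ _)/negP; apply.
  move=> t; rewrite /Q hornerN hornerM horner_comp !fdiffE !hornerE subrK.
  have := prod_on_line (normF g) w t 1; have := prod_on_line (normF g) w t 0.
  have := prod_on_line (normF g) w t (-1); rewrite -/A -/B addr0.
  rewrite /trans => Em E0 Ep.
  rewrite (eq_bigr (fun j => (normF g j).[t * direction w j + 0 * w j]));
    last first.
    by move=> j _; rewrite addrK mul0r addr0.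
  rewrite [X in _ - X - _](eq_bigr (fun j =>
    (normF g j).[t * direction w j + 1 * w j])); last first.
    by move=> j _; rewrite mul1r.
  rewrite [X in _ - _ - (X - _)](eq_bigr (fun j =>
    (normF g j).[t * direction w j + (-1) * w j])); last first.
    by move=> j _; rewrite mulN1r.
  rewrite [X in _ - _ - (_ - X)](eq_bigr (fun j =>
    (normF g j).[t * direction w j + 0 * w j])); last first.
    by move=> j _; rewrite mul0r addr0.
  by rewrite Em E0 Ep; ring.
have sA : size A = (\sum_(j | g.1 j != g.2 j) (g.1 j + g.2 j)).+1.
  rewrite /A size_moving //; congr _.+1; apply: eq_big => [j|j _].
    by rewrite w0E.
  by rewrite size_normF.
have sB : size B = (\sum_(j | g.1 j == g.2 j) (g.1 j + g.2 j)).+1.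
  by rewrite /B size_still //; congr _.+1; apply: eq_big => [j|j _];
    rewrite ?w0E ?size_normF.
have sDA : size (fdiff A) = (size A).-1 by rewrite size_fdiff // sA ltnS ltnW.
have sDDA : size (fdiff (fdiff A)) = (size A).-2.
  by rewrite size_fdiff sDA // sA.
have sC : size (fdiff (fdiff A) \Po ('X - 1%:P)) = (size A).-2.
  by rewrite size_comp_poly2 ?size_XsubC.
have C0 : fdiff (fdiff A) \Po ('X - 1%:P) != 0.
  by rewrite -size_poly_gt0 sC sA; case: (\sum_(_ | _) _)%N e2 => [|[]].
rewrite /Q size_polyN size_mul ?still_neq0 // sC sA sB.
move: d3; rewrite /Defs.mdeg (bigID (fun j => g.1 j != g.2 j)) /=.
rewrite [X in (_ < _ + X)%N](eq_bigl (fun j => g.1 j == g.2 j)) => [|j];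
  last by rewrite negbK.
move: e2; move: (\sum_(j | g.1 j != g.2 j) _)%N (\sum_(j | g.1 j == g.2 j) _)%N.
by move=> a b; lia.
Qed.

(** In [a^h, (a^h)^+] the linear factor of mode [l] is differenced to a constant and the balanced
    modes are untouched. The remaining product has degree at least two in mode [i], where [g] has
    weight. *)
Lemma om_growth M g h l i : findim_lie M ->
    M (amonF F g) -> M (amonF F h) -> M (amonF F (dag h)) ->
    (h.1 l + h.2 l = 1)%N -> (forall j, j != l -> h.1 j = h.2 j) ->
    g.1 i != g.2 i -> i != l -> (0 < h.1 i)%N ->
  False.
Proof.
move=> Mfd Mg Mh Mdh hl hd gi il hi.
pose E j := if j == l then 1 else normF h j.
have E0 j : E j != 0.
  rewrite /E; case: ifP => _; first exact: oner_neq0.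
  by rewrite -size_poly_gt0 size_normF.
have wl0 : - wt F h l != 0.
  by rewrite oppr_eq0 subr_eq0 eqr_nat; move: hl; lia.
have sEi : size (E i) = (h.1 i + h.2 i).+1 by rewrite /E (negPf il) size_normF.
have hiE := hd i il.
apply: (product_growth (i := i) (c := - wt F h l) (E := E) Mfd
  (findim_br Mfd Mh Mdh) Mg wl0 E0).
- move=> phi r; rewrite diagonal_norm; congr (_ * _).
  have -> : \prod_j (E j).[r j] = \prod_(j | j != l) (E j).[r j].
    by rewrite (bigD1 l) //= {1}/E eqxx hornerE mul1r.
  rewrite (bigD1 l) //= [X in _ - X](bigD1 l) //=.
  have eqE : \prod_(j | j != l) (normF h j).[r j - wt F h j] =
             \prod_(j | j != l) (E j).[r j].
    apply: eq_bigr => j jl; rewrite /E (negPf jl); congr (_.[_]).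
    by rewrite /wt (hd j jl) subrr subr0.
  have eqE' : \prod_(j | j != l) (normF h j).[r j] =
              \prod_(j | j != l) (E j).[r j].
    by apply: eq_bigr => j jl; rewrite /E (negPf jl).
  rewrite eqE eqE' -mulrBl; congr (_ * _).
  have f0 : ffp F 0 = 1 by rewrite /ffp big_ord0.
  have f1 : ffp F 1 = 'X by rewrite /ffp big_ord_recl big_ord0 mulr1 subr0.
  rewrite /normF /wt; case: (h.1 l) (h.2 l) hl => [|[|//]] [|[|//]] // _.
    by rewrite f0 f1 !hornerM !horner_comp !(hornerD, hornerX, hornerC); ring.
  by rewrite f0 f1 !hornerM !horner_comp !(hornerD, hornerX, hornerC); ring.
- by rewrite subr_eq0 eqr_nat.
- by rewrite sEi ltnS; lia.
by rewrite (bigD1 i) //= sEi /=; lia.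
Qed.

(** A monomial with equal exponents is itself diagonal, with a product of falling factorials as
    eigenvalue. *)
Lemma falling_growth M g h i : findim_lie M ->
    M (amonF F g) -> M (amonF F h) -> h.1 = h.2 -> (2 < Defs.mdeg h)%N ->
    g.1 i != g.2 i -> (0 < h.1 i)%N ->
  False.
Proof.
move=> Mfd Mg Mh hd d3 gi hi.
apply: (product_growth (i := i) (c := 1) (E := fun j => ffp F (h.2 j))
  Mfd Mh Mg).
- exact: oner_neq0.
- by move=> j; apply: ffp_neq0.
- move=> phi r; rewrite act_amon mul1r; congr (_ * phi _).
  by apply/funext => j; rewrite /trans /wt hd subrr addr0.
- by rewrite subr_eq0 eqr_nat.
- by rewrite size_ffp ltnS -hd.
rewrite (eq_bigr (fun j => h.2 j)) => [|j _]; last by rewrite size_ffp.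
by move: d3; rewrite /Defs.mdeg big_split /= hd; move: (\sum_j _)%N => d; lia.
Qed.

End FiniteDimensional.

(** * Classes of monomials *)

Section Classes.
Context (n : nat).
Implicit Types (g h mu : mono n).

Lemma ffun2_eq (a b : {ffun 'I_n -> nat}) : (forall j, a j = b j) -> a = b.
Proof. by move=> ab; apply/ffunP. Qed.

Lemma mdeg_dag g : Defs.mdeg (dag g) = Defs.mdeg g.
Proof. by apply: eq_bigr => j _; rewrite addnC. Qed.

Lemma mdeg_diag g : g.1 = g.2 -> Defs.mdeg g = ((\sum_j g.1 j).*2)%N.
Proof. by move=> gd; rewrite /Defs.mdeg -gd big_split /= addnn. Qed.

Lemma clsom_dag g : clsom g -> clsom (dag g).
Proof.
move=> [d3 [k [gk gj]]]; split; first by rewrite mdeg_dag.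
by exists k; split=> [|j /gj //]; rewrite addnC.
Qed.

Lemma in_cls_dag K g : in_cls K (dag g) <-> in_cls K g.
Proof.
have E0 : cls0 (dag g) <-> cls0 g.
  by rewrite /cls0 mdeg_dag; split=> -[? ?].
have E1 : cls1 (dag g) <-> cls1 g by rewrite /cls1 mdeg_dag.
have E2 : cls2 (dag g) <-> cls2 g.
  by rewrite /cls2 mdeg_dag; split=> -[? N]; split=> // ?; apply: N.
have Eeq : clseq (dag g) <-> clseq g.
  by rewrite /clseq mdeg_dag; split=> -[? ?].
have Eom : clsom (dag g) <-> clsom g.
  by split=> [/clsom_dag|/clsom_dag //]; rewrite dagK.
by case: K => //=; rewrite /clsperp; tauto.
Qed.

(** Supplies the two bounds of [norm_growth]. Degrees up to two are exhausted by the other classes;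
    and if the modes of nonzero weight held at most one operator in all, [g] would be diagonal or of
    type om. *)
Lemma clsperp_heavy g : clsperp g ->
  (1 < \sum_(j | g.1 j != g.2 j) (g.1 j + g.2 j))%N /\ (2 < Defs.mdeg g)%N.
Proof.
move=> [n0 [n1 [n2 [neq nom]]]].
have d3 : (2 < Defs.mdeg g)%N.
  rewrite ltnNge; apply/negP; rewrite leq_eqVlt ltnS leq_eqVlt ltnS leqn0.
  case/or3P => /eqP d.
  - by have [gd|gd] := pselect (g.1 = g.2); [apply: n0; split=> //;
    right|exact: n2].
  - exact: n1.
  apply: n0; split; last by left.
  move/eqP: d; rewrite /Defs.mdeg sum_nat_eq0 => /forallP d;
    apply: ffun2_eq => j.
  by have := d j; rewrite /= addn_eq0 => /andP[/eqP -> /eqP ->].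
split=> //; have [|le1] := ltnP 1 _; first by [].
have [[k gk]|alld] := pselect (exists k, g.1 k != g.2 k); last first.
  have gd : g.1 = g.2.
    by apply: ffun2_eq => j; apply/eqP/negPn/negP => gj; apply: alld; exists j.
  case: neq; split=> //; have := d3; rewrite (mdeg_diag gd).
  by case: (\sum_j _)%N => [|[]].
case: nom; split=> //; exists k; move: le1; rewrite (bigD1 k) //=.
set rest := (\sum_(i | _) _)%N => le1.
have rest0 : rest = 0%N by move: le1 gk; lia.
split; first by move: le1 gk; lia.
move=> j /eqP jk; apply/eqP/negPn/negP => gj.
by move: rest0; rewrite /rest (bigD1 j) ?gj //=; move: gj; lia.
Qed.

Lemma diag_not_perp g : g.1 = g.2 -> ~ clsperp g.
Proof.
move=> gd [n0 [_ [_ [neq _]]]]; apply: neq; split=> //.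
have := mdeg_diag gd => d; rewrite ltnNge; apply/negP => le3; apply: n0;
  split=> //.
by move: le3; rewrite d; case: (\sum_j _)%N => [|[|]] //; [left|right].
Qed.

Lemma off_diag g : g.1 <> g.2 -> exists j, g.1 j != g.2 j.
Proof.
move=> gN; apply: contrapT => nex; apply: gN; apply: ffun2_eq => j.
by apply/eqP/negPn/negP => gj; apply: nex; exists j.
Qed.

Lemma lex_total (a b : {ffun 'I_n -> nat}) : lex_ge a b \/ lex_gt b a.
Proof.
have [->|ab] := eqVneq a b; first by left; left.
have [j0 /= abj0] := @off_diag (a, b) (elimN eqP ab).
case: (arg_minnP (fun j : 'I_n => nat_of_ord j) (i0 := j0)
  (P := fun j => a j != b j) abj0) => k abk kmin.
have low (j : 'I_n) : (j < k)%N -> a j = b j.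
  by move=> jk; apply/eqP/negPn/negP => /kmin; rewrite leqNgt jk.
case: (ltngtP (a k) (b k)) abk => // abk _; [right|left; right]; exists k;
  split=> //.
by move=> j /low.
Qed.

Lemma two_weights_not_om g i k : i != k -> g.1 i != g.2 i -> g.1 k != g.2 k ->
  ~ clsom g.
Proof.
move=> ik gi gk [_ [l [_ gl]]].
have il : i = l by apply: contrapT => /gl/eqP; rewrite (negPf gi).
have kl : k = l by apply: contrapT => /gl/eqP; rewrite (negPf gk).
by rewrite il kl eqxx in ik.
Qed.

Lemma two_weights_perp g i k : i != k -> g.1 i != g.2 i -> g.1 k != g.2 k ->
  (2 < Defs.mdeg g)%N -> clsperp g.
Proof.
move=> ik gi gk d3; have nd : g.1 <> g.2 by move=> gd; rewrite gd eqxx in gi.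
split; first by case.
split; first by rewrite /cls1 => d1; rewrite d1 in d3.
split; first by case=> d2; rewrite d2 in d3.
by split; [case|exact: two_weights_not_om ik gi gk].
Qed.

Lemma mdeg_shift1 g h i : (0 < g.1 i + h.1 i)%N -> (0 < g.2 i + h.2 i)%N ->
  (Defs.mdeg (shift1 g h i) + 2 = Defs.mdeg g + Defs.mdeg h)%N.
Proof.
move=> gi hi; rewrite /Defs.mdeg -big_split /= (bigD1 i) //= [RHS](bigD1 i) //=.
rewrite !ffunE eqxx /=.
rewrite (eq_bigr (fun j => g.1 j + g.2 j + (h.1 j + h.2 j)))%N =>
  [|j /negPf ji].
  by move: (\sum_(_ | _) _)%N => s; lia.
by rewrite !ffunE ji /=; lia.
Qed.

End Classes.

(** * A bracket-stable space of bounded degree *)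

Section Closure.
Context (F : numFieldType) (n : nat) (S : pred 'I_n) (m : nat).
Context (m_gt0 : (0 < m)%N).
Local Notation weyl := {malg F[mono n]}.
Implicit Types (g h mu : mono n) (x y : weyl).

(* Monomials which are polynomials in the number operators on the modes of S;
   the weighted degree is subadditive, and drops by 2 m whenever a pair of modes
   outside S is contracted, so that bounding it by 2 m is stable under
   brackets. *)
Definition tame g :=
  (forall j, S j -> g.1 j = g.2 j) /\
  (m * (\sum_(j | ~~ S j) (g.1 j + g.2 j)) + \sum_(j | S j) g.1 j <= m.*2)%N.

(** Some contracted mode has nonzero weight in a factor and so lies outside [S]. The loss of 2 m
    there brings the sum of two weighted degrees, at most 4 m, back to 2 m. *)
Lemma tame_wbr g h mu : tame g -> tame h ->
  mu \in msupp (wbrF (amonF F g) (amonF F h)) -> tame mu.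
Proof.
move=> [gS gm] [hS hm] /wbr_amon_supp[k [kE _ [j kj nd]]].
have Sj : ~~ S j by apply: contra nd => Sj; rewrite (gS j Sj) (hS j Sj) !eqxx.
split.
  by move=> i Si; have := kE i; rewrite (gS i Si) (hS i Si); lia.
have dsum : (\sum_(j | ~~ S j) (mu.1 j + mu.2 j) + (\sum_(j | ~~ S j) k j).*2 =
    \sum_(j | ~~ S j) (g.1 j + g.2 j) + \sum_(j | ~~ S j) (h.1 j + h.2 j))%N.
  rewrite -addnn -!big_split /=; apply: eq_bigr => i _.
  by have := kE i; lia.
have esum : (\sum_(j | S j) mu.1 j <= \sum_(j | S j) g.1 j + \sum_(j | S j) h.1
  j)%N.
  by rewrite -big_split /=; apply: leq_sum => i _; have := kE i; lia.
have kpos : (0 < \sum_(j | ~~ S j) k j)%N by rewrite (bigD1 j) //= ltn_addr.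
move: dsum esum kpos gm hm.
move: (\sum_(j | ~~ S j) (mu.1 j + mu.2 j))%N (\sum_(j | ~~ S j) k j)%N
  (\sum_(j | ~~ S j) (g.1 j + g.2 j))%N (\sum_(j | ~~ S j) (h.1 j + h.2 j))%N
  (\sum_(j | S j) mu.1 j)%N (\sum_(j | S j) g.1 j)%N (\sum_(j | S j) h.1 j)%N.
move=> a b c d e f t abcd ef b0; rewrite -!muln2.
have -> : (a = c + d - b.*2)%N by lia.
by nia.
Qed.

Definition tame_elt x := forall mu, mu \in msupp x -> tame mu.

Lemma tame_elt_wbr x y : tame_elt x -> tame_elt y -> tame_elt (wbrF x y).
Proof.
move=> tx ty mu /wbr_supp[g [h [gx hy]]]; apply: tame_wbr;
  [exact: tx|exact: ty].
Qed.

Lemma tame_elt_comb c d x y : tame_elt x -> tame_elt y ->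
  tame_elt (c *: x + d *: y).
Proof.
move=> tx ty mu /(fsubsetP (msuppD_le _ _)); rewrite in_fsetU => /orP[] H.
  by apply: tx; apply: (fsubsetP (msuppZ_le _ _)) H.
by apply: ty; apply: (fsubsetP (msuppZ_le _ _)) H.
Qed.

(** Exponents are at most 2 off [S] and at most 2 m on it; 2 m + 3 exceeds both. *)
Lemma tame_bound g j : tame g -> (g.1 j < m.*2.+3)%N /\ (g.2 j < m.*2.+3)%N.
Proof.
move=> [gS]; have [Sj|Sj] := boolP (S j).
  rewrite -(gS j Sj) [X in (_ + X <= _)%N](bigD1 j) //=.
  by move: (\sum_(_ | _) _)%N (\sum_(_ | _) _)%N => a b; lia.
rewrite (bigD1 j) //=.
by move: (\sum_(_ | _) _)%N (\sum_(_ | _) _)%N => a b; rewrite -muln2; nia.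
Qed.

Definition box_mono N (t : {ffun 'I_n -> 'I_N} * {ffun 'I_n ->
  'I_N}) : mono n :=
  ([ffun j => nat_of_ord (t.1 j)], [ffun j => nat_of_ord (t.2 j)]).

Lemma box_sum N x :
    (forall mu, mu \in msupp x -> forall j, (mu.1 j < N)%N /\ (mu.2 j < N)%N) ->
  x = \sum_t x@_(@box_mono N t) *: amonF F (box_mono t).
Proof.
move=> xN; apply/malgP => mu; rewrite raddf_sum /=.
under eq_bigr => t _ do rewrite mcoeffZ mcoeff_amon.
have [mux|mux] := boolP (mu \in msupp x); last first.
  rewrite (mcoeff_outdom mux) big1 // => t _.
  by have [->|_] := eqVneq; rewrite ?mulr0 // (mcoeff_outdom mux) mul0r.
have muN := xN mu mux.
pose t0 : {ffun 'I_n -> 'I_N} * {ffun 'I_n -> 'I_N} :=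
  ([ffun j => Ordinal (muN j).1], [ffun j => Ordinal (muN j).2]).
have t0E : box_mono t0 = mu.
  rewrite [RHS]surjective_pairing; congr pair; apply/ffunP => j;
    by rewrite !ffunE.
rewrite (bigD1 t0) //= t0E eqxx mulr1 big1 ?addr0 // => t tt0.
have [tmu|_] := eqVneq; last by rewrite mulr0.
case/eqP: tt0; move: tmu; rewrite -t0E => -[/ffunP t1 /ffunP t2].
rewrite [t]surjective_pairing [t0]surjective_pairing; congr pair;
  apply/ffunP => j;
  apply: val_inj; [have := t1 j|have := t2 j]; by rewrite !ffunE.
Qed.

End Closure.

(** * Commutators between the classes of monomials *)

Section Conditions.
Context (F : numFieldType) (n : nat).
Local Notation weyl := {malg F[mono n]}.
Implicit Types (g h mu : mono n) (x y : weyl).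

Lemma wbr_eq0 x y : (forall mu, mu \notin msupp (wbrF x y)) -> wbrF x y = 0.
Proof. by move=> E; apply/malgP => mu; rewrite mcoeff0 mcoeff_outdom. Qed.

(** As [g] is diagonal, an effective contraction needs a mode where [h] has nonzero weight, and
    there [g] has no operator to contract. *)
Lemma commute_diag x y :
    (forall g h, g \in msupp x -> h \in msupp y -> g.1 = g.2 /\
       forall j, h.1 j != h.2 j -> g.1 j = 0%N) ->
  wbrF x y = 0.
Proof.
move=> xy; apply: wbr_eq0 => mu; apply/negP => /wbr_supp[g [h [gx hy]]].
move=> /wbr_amon_supp[k [_ le_k [j kj nd]]];
  have [gd /(_ j) gj0] := xy g h gx hy.
move: nd; rewrite gd eqxx /= => /gj0 gj.
by case: le_k => /(_ j) []; rewrite -?gd gj; move: kj; lia.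
Qed.

Lemma om_quadratic_bracket g h mu : cls2 g -> clsom h ->
    (forall i, g.1 i != g.2 i -> h.1 i + h.2 i <= 1)%N ->
  mu \in msupp (wbrF (amonF F g) (amonF F h)) -> clsom mu.
Proof.
move=> [g2 gN] [h3 [l [hl hd]]] disj /wbr_amon_supp[k [kE le_k [j kj nd]]].
have [i0 gi0] := off_diag gN.
(* A balanced mode would use up both operators of the quadratic [g] and leave it diagonal. *)
have g_supp i : (0 < g.1 i + g.2 i)%N -> g.1 i != g.2 i.
  move=> gi; apply/negP => /eqP gid; have ii0 : i != i0.
    by apply: contraNneq gi0 => <-; apply/eqP.
  move: g2; rewrite /Defs.mdeg (bigD1 i) //= (bigD1 i0) //=; first by lia.
  by rewrite eq_sym.
have k_supp i : (0 < k i)%N -> i = l.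
  move=> ki; apply: contrapT => il; have hi := hd i il.
  have gi : (0 < g.1 i + g.2 i)%N by case: le_k => /(_ i); lia.
  have := disj i (g_supp i gi); rewrite hi; case: le_k => /(_ i); rewrite ?hi;
    lia.
have jl := k_supp j kj; rewrite jl {j jl nd} in kj.
have kl : k l = 1%N by case: le_k => /(_ l); lia.
have k0 i : i != l -> k i = 0%N.
  by move=> il; apply/eqP; rewrite -leqn0 leqNgt;
    apply: contra il => /k_supp ->.
have gl : (0 < g.1 l + g.2 l)%N by case: le_k => /(_ l); lia.
have mu_sum i : i != l ->
    (mu.1 i + mu.2 i = g.1 i + g.2 i + (h.1 i + h.2 i))%N.
  by move=> il; have := kE i; rewrite k0 //; lia.
have d_mu : (Defs.mdeg mu + 2 = Defs.mdeg g + Defs.mdeg h)%N.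
  rewrite /Defs.mdeg -big_split /= (bigD1 l) //= [RHS](bigD1 l) //=.
  rewrite (eq_bigr _ (fun i il => mu_sum i il)).
  have := kE l; rewrite kl; move: (\sum_(_ | _) _)%N => s; lia.
split; first by move: h3 d_mu; rewrite g2; lia.
(* g has two legs; one is contracted with the odd leg of h and the other one
   is the odd leg of mu. *)
have rest : (\sum_(i | i != l) (g.1 i + g.2 i) + (g.1 l + g.2 l) = 2)%N.
  by rewrite -g2 /Defs.mdeg addnC [RHS](bigD1 l).
have [gl2|gl1] := ltnP 1 (g.1 l + g.2 l).
  exists l; split; first by have := kE l; rewrite kl; move: rest; lia.
  move=> i /eqP il; have := kE i; rewrite k0 //.
  have : (g.1 i + g.2 i = 0)%N.
    by move: rest; rewrite (bigD1 i) //=; move: gl2; lia.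
  by have := hd i (elimN eqP il); lia.
have [i1 i1l gi1] : exists2 i, i != l & (0 < g.1 i + g.2 i)%N.
  apply: contrapT => nex; move: rest; rewrite big1 => [|i il];
    first by move: gl1; lia.
  by apply/eqP; rewrite -leqn0 leqNgt; apply/negP => gi; apply: nex; exists i.
have h_i1 : (h.1 i1 + h.2 i1 = 0)%N.
  have := disj i1 (g_supp i1 gi1); have := hd i1 (elimN eqP i1l); lia.
have rest1 : (g.1 i1 + g.2 i1 + \sum_(i | (i != l) && (i != i1)) (g.1 i + g.2
  i) = 1)%N.
  by move: rest; rewrite (bigD1 i1) //=; move: gl gl1; lia.
exists i1; split; first by rewrite mu_sum // h_i1; move: rest1 gi1; lia.
move=> i /eqP ii1; have [->|il] := eqVneq i l.
  by have := kE l; rewrite kl; case: le_k => /(_ l); move: hl gl1 gl; lia.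
have gi : (g.1 i + g.2 i = 0)%N.
  by move: rest1; rewrite (bigD1 i) ?il //=; move: gi1; lia.
by have := kE i; rewrite k0 //; have := hd i (elimN eqP il); lia.
Qed.

(** If the odd modes differ, each factor is absent from the odd mode of the other and nothing
    effective is contracted. If they agree, the two odd operators are contracted with each other. *)
Lemma om_om_bracket g h mu : clsom g -> clsom h ->
    (forall i, g.1 i != g.2 i -> h.1 i + h.2 i <= 1)%N ->
    (forall i, h.1 i != h.2 i -> g.1 i + g.2 i <= 1)%N ->
  mu \in msupp (wbrF (amonF F g) (amonF F h)) -> mu.1 = mu.2.
Proof.
move=> [_ [a [ga gd]]] [_ [b [hb hd]]] gh hg /wbr_amon_supp[k [kE le_k [j kj
  nd]]].
have gN : g.1 a != g.2 a by move: ga; lia.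
have hN : h.1 b != h.2 b by move: hb; lia.
have ab : a = b.
  apply: contrapT => ab; have gb := gd b (fun ba => ab (esym ba)).
  have ha := hd a ab; have := gh a gN; have := hg b hN => gb1 ha1.
  have [ja|/eqP ja] := eqVneq j a.
    by move: kj; rewrite ja; case: le_k => /(_ a); lia.
  have [jb|/eqP jb] := eqVneq j b.
    by move: kj; rewrite jb; case: le_k => /(_ b); lia.
  by move: nd; rewrite (gd j ja) (hd j jb) !eqxx.
have ja : j = a.
  apply: contrapT => ja; move: nd; rewrite (gd j ja) hd ?eqxx //.
  by rewrite -ab.
apply: ffun2_eq => i; have := kE i; have [->|/eqP ia] := eqVneq i a.
  by rewrite ja in kj; rewrite -ab in hb; case: le_k => /(_ a); lia.
by rewrite (gd i ia) hd -?ab //; lia.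
Qed.

End Conditions.

(** * Complexification of a real Lie algebra *)

Section ModuleIdentities.
Context (F : numFieldType) (V : lmodType F).
Implicit Types (s t im : F) (p q a b : V).

Lemma skew_term s t im p q :
  (s + im * t) *: p - (s - im * t) *: q =
  2 *: ((t / 2) *: (im *: (q + p)) + (- s / 2) *: (q - p)).
Proof.
rewrite scalerDr !scalerA.
have -> : 2 * (t / 2) * im = im * t by field.
have -> : 2 * (- s / 2) = - s by field.
rewrite scaleNr !scalerBr scalerDl scalerBl scalerDr !opprB.
by rewrite addrACA [RHS]addrACA [s *: p + _]addrC.
Qed.

Lemma complex_scale s t im a b a' b' : im * im = -1 ->
  (s + im * t) *: (a + im *: b) + (a' + im *: b') =
  (s *: a - t *: b + a') + im *: (t *: a + s *: b + b').
Proof.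
move=> im2; rewrite scalerDl !scalerDr !scalerA.
have -> : im * t * im = - t by rewrite mulrAC im2 mulN1r.
rewrite scaleNr [s * im]mulrC [RHS]addrACA; congr (_ + _).
by rewrite addrACA [RHS]addrACA; congr (_ + _); rewrite addrC.
Qed.

Lemma complex_bilinear (B : V -> V -> V) (Bl : forall y, linear (B ^~ y))
    (Br : forall x, linear (B x)) im a b a' b' : im * im = -1 ->
  B (a + im *: b) (a' + im *: b') =
  (B a a' - B b b') + im *: (B a b' + B b a').
Proof.
move=> im2; rewrite addrC [a' + _]addrC (Bl _) /= !Br scalerDr !scalerA im2.
by rewrite scaleN1r scalerDr [RHS]addrACA [LHS]addrC [B a a' + _]addrC.
Qed.

Lemma half_sum (u v : F) p q : u *: q + v *: p + (v *: p - u *: q) = (2 * v) *: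
  p.
Proof. by rewrite addrC addrA subrK -scalerDl mulr_natl mulr2n. Qed.

Lemma half_diff (u v : F) p q :
  - (v *: p - u *: q) + (u *: q + v *: p) = (2 * u) *: q.
Proof.
by rewrite opprB [u *: q + _]addrC addrA subrK -scalerDl mulr_natl mulr2n.
Qed.

Lemma eigen_comb (f : {linear V -> V}) (w u v : F) p q :
    f p = w *: p -> f q = - w *: q ->
  f (u *: q + v *: p) = w *: (v *: p - u *: q).
Proof.
move=> fp fq; have -> : f (u *: q + v *: p) = u *: f q + v *: f p.
  by rewrite linearD !linearZ.
rewrite fp fq scalerBr !scalerA mulrN scaleNr addrC.
by rewrite [v * w]mulrC [u * w]mulrC.
Qed.

End ModuleIdentities.

Section RealForm.
Context (K F : numFieldType) (n : nat).
Context (rho : {rmorphism K -> F}) (cj : {rmorphism F ->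
  F}) (im : F) (re ip : F -> K).
Context (im2 : im * im = -1) (cj_im : cj im = - im)
  (cj_rho : forall r, cj (rho r) = rho r)
  (cartesian : forall z, z = rho (re z) + im * rho (ip z)).
Local Notation weyl := {malg F[mono n]}.
Local Notation gs := (@gsigF F n cj im).
Implicit Types (g h mu : mono n) (x y a b : weyl).

Lemma im_neq0 : im != 0.
Proof.
by apply/eqP => im0; have /eqP := im2; rewrite im0 mul0r eq_sym oppr_eq0
  oner_eq0.
Qed.

(** Twice a skew element is x minus its adjoint, taken term by term. The lexicographic choice
    between [g] and [dag g] is left to [span_skew_term]. *)
Lemma skew_decomp x : wdagF cj x = - x ->
  x = \sum_(g <- msupp x) (rho (ip x@_g / 2) *: gs true g + rho (- re x@_g / 2)
    *: gs false g).
Proof.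
move=> xS; have dE : wdagF cj x = \sum_(g <- msupp x) cj x@_g *: amonF F (dag
  g).
  by rewrite {1}[x]sum_amon wdag_sum; apply: eq_bigr => g _;
    rewrite wdagZ wdag_amon.
have two0 : (2 : F) != 0 by rewrite pnatr_eq0.
apply: (scalerI two0); rewrite scaler_sumr.
have -> : 2 *: x = x - wdagF cj x by rewrite xS opprK scaler_nat mulr2n.
rewrite {1}[x]sum_amon dE -sumrB; apply: eq_bigr => g _.
rewrite gsigF.unlock wdag_amon; move: (amonF F g) (amonF F (dag g)) => p q.
have cz : cj x@_g = rho (re x@_g) - im * rho (ip x@_g).
  by rewrite {1}[x@_g]cartesian rmorphD rmorphM cj_im !cj_rho mulNr.
rewrite cz {1}[x@_g]cartesian; move: (re _) (ip _) => s t.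
rewrite !rmorphM rmorphN fmorphV rmorph_nat.
exact: skew_term.
Qed.

Section Complexification.
Context (L : weyl -> Prop).
Context (L0 : L 0) (LD : forall x y, L x -> L y -> L (x + y))
  (LZ : forall r x, L x -> L (rho r *: x))
  (Lbr : forall x y, L x -> L y -> L (wbrF x y)).

Definition complexified x := exists a b, [/\ L a, L b & x = a + im *: b].

Lemma sub_complexified x : L x -> complexified x.
Proof. by move=> Lx; exists x, 0; split; rewrite ?scaler0 ?addr0. Qed.

Lemma LN x : L x -> L (- x).
Proof. by move=> Lx; have := LZ (-1) Lx; rewrite rmorphN rmorph1 scaleN1r. Qed.

Lemma complexified_comb c x y :
  complexified x -> complexified y -> complexified (c *: x + y).
Proof.
move=> [a [b [La Lb ->]]] [a' [b' [La' Lb' ->]]].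
exists (rho (re c) *: a - rho (ip c) *: b + a'),
  (rho (ip c) *: a + rho (re c) *: b + b').
split; [by apply: LD => //; apply: LD; [exact: LZ|apply/LN/LZ]|by do 2?apply:
  LD => //; exact: LZ|].
rewrite {1}[c]cartesian; move: (re c) (ip c) => s t.
exact: complex_scale.
Qed.

Lemma complexifiedZ c x : complexified x -> complexified (c *: x).
Proof.
move=> Mx; rewrite -[c *: x]addr0; apply: complexified_comb => //.
exact: sub_complexified.
Qed.

Lemma findim_complexified (s : seq weyl) :
    (forall x, L x -> exists c : seq K, x = \sum_(i < size s) rho c`_i *: s`_i)
      ->
  findim_lie complexified.
Proof.
move=> Ls; split; first exact: complexified_comb.
  move=> x y [a [b [La Lb ->]]] [a' [b' [La' Lb' ->]]].
  exists (wbrF a a' - wbrF b b'), (wbrF a b' + wbrF b a').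
  split; [by apply: LD; [exact: Lbr|apply/LN/Lbr]|by apply: LD; exact: Lbr|].
  exact: (complex_bilinear (@wbr_linl F n) (@wbr_linr F n)).
exists (size s), (fun i => s`_i) => x [a [b [/Ls[c ->] /Ls[d ->] ->]]].
exists (fun i => rho c`_i + im * rho d`_i).
by rewrite scaler_sumr -big_split; apply: eq_bigr => i _ /=;
  rewrite scalerDl scalerA.
Qed.

(** Under a number operator of a mode where [g] has weight, [g] and [dag g] have opposite
    eigenvalues. The bracket thus flips their relative sign, and sums and differences isolate each
    of them. *)
Lemma complexified_amon sigma g : is_basis sigma g -> L (gs sigma g) ->
    (forall k, L (im *: amonF F (num_mono k))) ->
  complexified (amonF F g) /\ complexified (amonF F (dag g)).
Proof.
move=> gb Lg LN'; have Mg := sub_complexified Lg.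
have [u [v [u0 v0 E uv]]] := gsigE cj im_neq0 sigma g.
have [gd|gd] := eqVneq (dag g) g.
  have Mgg : complexified (amonF F g).
    have := complexifiedZ (u + v)^-1 Mg.
    by rewrite E gd -scalerDl scalerA mulVf ?scale1r ?uv.
  by rewrite gd.
have [k gk] : exists k, g.1 k != g.2 k.
  apply: off_diag => gE; case/eqP: gd.
  by rewrite [RHS]surjective_pairing /dag gE.
have w0 : (g.1 k)%:R - (g.2 k)%:R != 0 :> F by rewrite subr_eq0 eqr_nat.
set w : F := _ - _ in w0.
have Mbr : complexified (im *: wbrF (amonF F (num_mono k)) (gs sigma g)).
  by rewrite -wbrZl; apply/sub_complexified/Lbr.
have brE : wbrF (amonF F (num_mono k)) (gs sigma g) =
    w *: (v *: amonF F g - u *: amonF F (dag g)).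
  rewrite E; apply: eigen_comb; first exact: wbr_num_mono.
  by apply: etrans (wbr_num_mono _ _ _) _; rewrite /w opprB.
have Md : complexified (v *: amonF F g - u *: amonF F (dag g)).
  have := complexifiedZ (im * w)^-1 Mbr.
  by rewrite brE !scalerA -mulrA mulVf ?scale1r // mulf_neq0 // im_neq0.
have two0 : (2 : F) != 0 by rewrite pnatr_eq0.
split.
  have := complexifiedZ (2 * v)^-1 (complexified_comb 1 Mg Md).
  rewrite E scale1r; move: (amonF F g) (amonF F (dag g)) => p q.
  by rewrite half_sum scalerA mulVf ?scale1r // mulf_neq0.
have := complexifiedZ (2 * u)^-1 (complexified_comb (-1) Md Mg).
rewrite E scaleN1r; move: (amonF F g) (amonF F (dag g)) => p q.
by rewrite half_diff scalerA mulVf ?scale1r // mulf_neq0.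
Qed.

End Complexification.

End RealForm.

Lemma msupp_sum (K : choiceType) (F : comNzRingType) (T : eqType) (s : seq T)
    (c : T -> F) (E : T -> {malg F[K]}) (k : K) :
  k \in msupp (\sum_(t <- s) c t *: E t) -> exists2 t,
    t \in s & k \in msupp (E t).
Proof.
rewrite -mcoeff_neq0 => k0; apply: contrapT => nex; case/negP: k0; apply/eqP.
rewrite raddf_sum big1_seq //= => t ts; rewrite mcoeffZ [X in _ * X](_ : _ = 0)
  ?mulr0 //.
by apply/mcoeff_outdom/negP => kt; apply: nex; exists t.
Qed.

Lemma cartesian_sum (K F : numFieldType) (rho : {rmorphism K -> F})
    (V : lmodType F) (T : Type) (e : seq T) (a b : T -> K) (E E' : T -> V) :
  \sum_(i < size ([seq E t | t <- e] ++ [seq E' t | t <- e]))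
     rho ([seq a t | t <- e] ++ [seq b t | t <- e])`_i *:
     ([seq E t | t <- e] ++ [seq E' t | t <- e])`_i =
  \sum_(t <- e) (rho (a t) *: E t + rho (b t) *: E' t).
Proof.
set cs := map a e ++ _; set ss := map E e ++ _.
have size_cs : size cs = size ss by rewrite !size_cat !size_map.
have -> : \sum_(i < size ss) rho cs`_i *: ss`_i =
    \sum_(p <- zip cs ss) rho p.1 *: p.2.
  rewrite (big_nth (0, 0)) big_mkord size_zip size_cs minnn.
  by apply: eq_bigr => i _; rewrite nth_zip.
by rewrite zip_cat ?size_map // big_cat !zip_map !big_map big_split.
Qed.

Lemma cartesian_scale (F : numFieldType) (V : lmodType F) (im z s t : F) (p :
  V) :
  z = s + im * t -> z *: p = s *: p + t *: (im *: p).
Proof. by move=> ->; rewrite scalerDl scalerA [im * t]mulrC. Qed.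

(** * Skew-hermitian elements and spans of basis elements *)

Section Bridge.
Context (R : realType) (n : nat).
Local Notation C := (R[i]).
Local Notation mono := (mono n).
Local Notation weyl := (weyl R n).
Local Notation gs := (@gsigF C n (@conjc R) (iC R)).
Implicit Types (g h mu : mono) (x y : weyl).

Lemma amonE g : amon R g = amonF C g.
Proof. by rewrite amonF.unlock. Qed.

Lemma mono_mulE g h : mono_mul R g h = mono_mulF C g h.
Proof. by rewrite mono_mulF.unlock. Qed.

Lemma wmulE x y : wmul x y = wmulF x y.
Proof.
rewrite wmulF.unlock /wmul /lext; apply: eq_bigr => g _; rewrite scaler_sumr.
by apply: eq_bigr => h _; rewrite scalerA mono_mulE.
Qed.

Lemma wbrE x y : wbr x y = wbrF x y.
Proof. by rewrite wbrF.unlock /wbr !wmulE. Qed.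

Lemma wdagE x : wdag x = wdagF (@conjc R) x.
Proof. by rewrite wdagF.unlock. Qed.

Lemma gsig_E sigma g : gsig R sigma g = gs sigma g.
Proof. by rewrite gsigF.unlock /gsig /gplus /gminus wdagE amonE. Qed.

Lemma iC2 : iC R * iC R = -1.
Proof. by apply/eqP; rewrite eq_complex /= !mul0r !mulr0 mul1r sub0r addr0
  oppr0 !eqxx. Qed.

Lemma conj_iC : conjc (iC R) = - iC R.
Proof. by apply/eqP; rewrite eq_complex /= oppr0 !eqxx. Qed.

Lemma iC_neq0 : iC R != 0.
Proof. by rewrite eq_complex /= oner_eq0 andbF. Qed.

Section Span.
Context (P : mono -> Prop) (Pdag : forall g, P g -> P (dag g)).
Local Notation span := (Defs.span_basis (fun _ g => P g)).

Lemma span_msupp x : span x -> forall mu, mu \in msupp x -> P mu.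
Proof.
move=> [s [sP ->]] mu /msupp_sum[t ts]; have [_ Pt] := sP t ts.
rewrite gsig_E => /(msupp_gsig iC_neq0)[-> //|->]; exact: Pdag.
Qed.

Lemma span0 : span (0 : weyl).
Proof. by exists [::]; split; rewrite ?big_nil. Qed.

Lemma spanD x y : span x -> span y -> span (x + y).
Proof.
move=> [s [sP ->]] [t [tP ->]]; exists (s ++ t); rewrite big_cat; split=> // u.
by rewrite mem_cat => /orP[/sP|/tP].
Qed.

Lemma span_gsig r sigma g : is_basis sigma g -> P g ->
  span (r%:C *: gs sigma g).
Proof.
move=> gb Pg; exists [:: (r, (sigma, g))]; rewrite big_seq1 /= gsig_E;
  split=> // t.
by rewrite inE => /eqP ->.
Qed.

Lemma gs_dag sigma g : gs sigma (dag g) = if sigma then gs sigma g else - gs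
  sigma g.
Proof.
rewrite gsigF.unlock; case: sigma.
  by rewrite (wdag_amon (@conjc R)) (wdag_amon (@conjc R)) dagK addrC.
by rewrite (wdag_amon (@conjc R)) (wdag_amon (@conjc R)) dagK opprB.
Qed.

(** If the lexicographic order selects [dag g] instead of [g], the exchange fixes g_+ and negates
    g_-; for self-adjoint [g], g_- vanishes. *)
Lemma span_skew_term r r' g : P g -> span (r%:C *: gs true g + r'%:C *: gs
  false g).
Proof.
move=> Pg; have Pg' := Pdag Pg.
have [[gd|gl]|lg] := lex_total g.1 g.2.
- have -> : gs false g = 0.
    rewrite gsigF.unlock (wdag_amon (@conjc R)).
    have -> : dag g = g by rewrite [RHS]surjective_pairing /dag gd.
    by rewrite subrr.
  by rewrite scaler0 addr0; apply: span_gsig => //; left.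
- by apply: spanD; apply: span_gsig => //; right.
have t := gs_dag true (dag g); have f := gs_dag false (dag g).
rewrite dagK in t f; rewrite t f scalerN -scaleNr -rmorphN.
by apply: spanD; apply: span_gsig => //; right.
Qed.

(** With [span_msupp], this reduces membership of skew elements in the subspaces to an inspection of
    supports. *)
Lemma span_of_msupp x : wdagF (@conjc R) x = - x ->
  (forall mu, mu \in msupp x -> P mu) -> span x.
Proof.
move=> xS xP.
rewrite (skew_decomp (rho := real_complex R) (re := @complex.Re R) (ip :=
  @complex.Im R)
  conj_iC (@conjc_real R) (@complexE R) xS).
rewrite big_seq_cond; apply: big_ind => [|a b|g /andP[gx _]].
- exact: span0.
- exact: spanD.
by apply: span_skew_term; apply: xP.
Qed.

End Span.

Lemma subA_gsig K sigma g : is_basis sigma g -> in_cls K g ->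
  subA K (gs sigma g).
Proof.
move=> gb gK; rewrite -[gs _ _]scale1r -[1]/(1%:C : C).
exact: span_gsig.
Qed.

Lemma subA_msupp K x : subA K x -> forall mu, mu \in msupp x -> in_cls K mu.
Proof. by apply: span_msupp => g; rewrite in_cls_dag. Qed.

Lemma fin_dim_box (L : weyl -> Prop) N :
    (forall x, L x -> forall mu, mu \in msupp x ->
       forall j, (mu.1 j < N)%N /\ (mu.2 j < N)%N) ->
  fin_dim L.
Proof.
move=> LN; set e := enum (({ffun 'I_n -> 'I_N} * {ffun 'I_n ->
  'I_N})%type : finType).
pose E (t : {ffun 'I_n -> 'I_N} * {ffun 'I_n -> 'I_N}) := amonF C (box_mono t).
exists ([seq E t | t <- e] ++ [seq iC R *: E t | t <- e]).
move=> x /LN/(@box_sum C n N x) xE.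
exists ([seq complex.Re x@_(box_mono t) | t <- e] ++ [seq complex.Im
  x@_(box_mono t) | t <- e]).
rewrite (cartesian_sum (real_complex R)) {1}xE big_enum /=.
by apply: eq_bigr => t _; apply: cartesian_scale; apply: complexE.
Qed.

End Bridge.

(** * Generators and decoupling *)

Section Generators.
Context (R : realType) (n : nat) (I : finType) (sigma : I ->
  bool) (gamma : I -> mono n).
Context (hbasis : forall p : I, is_basis (sigma p) (gamma p)).
Local Notation C := (R[i]).
Local Notation weyl := (weyl R n).
Local Notation gs := (@gsigF C n (@conjc R) (iC R)).
Implicit Types (g h mu : mono n) (x y : weyl).

Definition generator x : Prop :=
  (exists k : 'I_n, x = iC R *: amon R (num_mono k)) \/
  (exists p : I, x = gsig R (sigma p) (gamma p)).

Definition leading g : Prop :=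
  (exists k : 'I_n, g = num_mono k) \/ (exists p : I, g = gamma p).

(** The condition on exponents through which both sides of the theorem are compared. By the last
    clause [h] may still occupy mode [i] with its odd operator. *)
Definition decoupled : Prop :=
  [/\ forall g, leading g -> ~ clsperp g,
      forall g h i, leading g -> leading h -> clseq h ->
        g.1 i != g.2 i -> h.1 i = 0%N &
      forall g h i, leading g -> leading h -> clsom h ->
        g.1 i != g.2 i -> (h.1 i + h.2 i <= 1)%N].

Lemma num_mono_diag (k : 'I_n) : (num_mono k).1 = (num_mono k).2.
Proof. by []. Qed.

Lemma num_mono_mdeg (k : 'I_n) : Defs.mdeg (num_mono k) = 2.
Proof.
rewrite mdeg_diag // (bigD1 k) //= ffunE eqxx big1 // => j /negPf jk.
by rewrite ffunE jk.
Qed.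

Lemma clsom_off_diag g : clsom g -> exists2 l, (g.1 l + g.2 l = 1)%N &
  g.1 l != g.2 l /\ forall j, j != l -> g.1 j = g.2 j.
Proof.
move=> [_ [l [gl gd]]]; exists l => //; split; first by move: gl; lia.
by move=> j /eqP; apply: gd.
Qed.

Lemma generator_leading x : generator x -> exists g,
  [/\ leading g, g \in msupp x, wdagF (@conjc R) x = - x &
      forall mu, mu \in msupp x -> mu = g \/ mu = dag g].
Proof.
case=> [[k ->]|[p ->]]; last first.
  exists (gamma p); rewrite gsig_E; split.
  - by right; exists p.
  - exact: (gsig_msupp (@conjc R) (iC_neq0 R) (hbasis p)).
  - exact: (skew_gsig (cj := @conjc R) (conj_iC R)).
  by move=> mu; apply: (msupp_gsig (iC_neq0 R)).
have dN : dag (num_mono k) = num_mono k by [].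
exists (num_mono k); rewrite amonE; split.
- by left; exists k.
- by rewrite -mcoeff_neq0 mcoeffZ mcoeff_amon eqxx mulr1 iC_neq0.
- rewrite (wdagZ (@conjc R)) (wdag_amon (@conjc R)) dN.
  by rewrite [X in X *: _](conj_iC R) scaleNr.
move=> mu; rewrite -mcoeff_neq0 mcoeffZ mcoeff_amon.
have [<-|_] := eqVneq (num_mono k) mu; first by left.
by rewrite mulr0 eqxx.
Qed.

(** In the complexification every generator is replaced by its monomial and the adjoint monomial.
    The clauses then follow from [norm_growth], [falling_growth] and [om_growth] in turn. *)
Lemma findim_decoupled : fin_dim (lie_gen generator) -> decoupled.
Proof.
move=> [s Ls].
have Lbr x y : lie_gen generator x -> lie_gen generator y ->
  lie_gen generator (wbrF x y).
  by move=> Lx Ly; rewrite -wbrE; apply: lg_br.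
have Mfd := findim_complexified (rho := real_complex R) (re := @complex.Re R)
  (ip := @complex.Im R) (iC2 R) (@complexE R)
  (@lg_add _ _ generator) (@lg_scale _ _ generator) Lbr Ls.
have LN k : lie_gen generator (iC R *: amonF C (num_mono k)).
  by apply: lg_gen; left; exists k; rewrite amonE.
have Mp p := complexified_amon (rho := real_complex R) (re := @complex.Re R)
  (ip := @complex.Im R) (cj := @conjc R) (iC2 R) (@complexE R)
  (lg_zero generator) (@lg_add _ _ generator) (@lg_scale _ _ generator) Lbr
    (hbasis p)
  (lg_gen (or_intror (ex_intro _ p (esym (gsig_E R (sigma p) (gamma p)))))) LN.
split.
- move=> g [[k ->]|[p ->]]; first exact: diag_not_perp.
  move=> /clsperp_heavy[e2 d3].
  exact: norm_growth Mfd (Mp p).1 (Mp p).2 e2 d3.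
- move=> g h i [[k ->]|[p ->]]; first by rewrite num_mono_diag eqxx.
  move=> [[k ->]|[q ->]]; first by case=> _; rewrite num_mono_mdeg.
  move=> [hd d4] gi; apply/eqP; rewrite -leqn0 leqNgt; apply/negP => hi.
  exact: falling_growth Mfd (Mp p).1 (Mp q).1 hd (ltnW d4) gi hi.
move=> g h i [[k ->]|[p ->]]; first by rewrite num_mono_diag eqxx.
move=> [[k ->]|[q ->]]; first by case; rewrite num_mono_mdeg.
move=> /clsom_off_diag[l hl [_ hd]] gi; rewrite leqNgt; apply/negP => hi.
have il : i != l by apply: contraTneq hi => ->; rewrite hl.
apply: (om_growth (i := i) (l := l) Mfd (Mp p).1 (Mp q).1 (Mp q).2) => //.
by have := hd i il; lia.
Qed.

(** * From decoupling to conditions (i)-(iv) *)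

Section Decoupled.
Context (dec : decoupled).

Lemma decoupled_not_perp x : ~ (generator x /\ subA Kperp x).
Proof.
move=> [/generator_leading[g [lg gx _ _]] /subA_msupp/(_ g gx)].
by have [np _ _] := dec; apply: np.
Qed.

Lemma decoupled_central x y : generator x -> subA Keq x -> generator y ->
  wbr x y = 0.
Proof.
move=> /generator_leading[h [lh hx _ xh]] xeq /generator_leading[g [lg _ _ yg]].
have heq : clseq h by exact: subA_msupp xeq _ hx.
rewrite wbrE; apply: commute_diag => h' g' /xh h'E /yg g'E.
have [hd _] := heq; have [_ c _] := dec.
split=> [|j gj]; first by case: h'E => ->.
have hj : h.1 j = 0%N.
  by apply: (c g h j lg lh heq); case: g'E gj => -> //; rewrite eq_sym.
by case: h'E => -> //=; rewrite -hd.
Qed.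

Lemma decoupled_om x y g' h' i : generator x -> generator y -> subA Kom y ->
    g' \in msupp x -> h' \in msupp y -> g'.1 i != g'.2 i ->
  (h'.1 i + h'.2 i <= 1)%N.
Proof.
move=> /generator_leading[g [lg _ _ xg]] /generator_leading[h [lh hy _ yh]] yom.
move=> /xg g'E /yh h'E gi; have hom : clsom h by exact: subA_msupp yom _ hy.
have [_ _ c] := dec; have gi' : g.1 i != g.2 i.
  by case: g'E gi => -> //; rewrite eq_sym.
by have := c g h i lg lh hom gi'; case: h'E => -> //; rewrite addnC.
Qed.

Lemma skew_generator x : generator x -> wdagF (@conjc R) x = - x.
Proof. by case/generator_leading => g []. Qed.

Lemma decoupled_quadratic x y : generator x -> subA K2 x -> generator y ->
  subA Kom y ->
  subA Kom (wbr x y).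
Proof.
move=> Gx x2 Gy yom; rewrite wbrE; apply: span_of_msupp => [g|//|].
- by rewrite in_cls_dag.
- exact: (wdag_wbr (skew_generator Gx) (skew_generator Gy)).
move=> mu /wbr_supp[g [h [gx hy]]]; apply: om_quadratic_bracket.
- exact: subA_msupp x2 _ gx.
- exact: subA_msupp yom _ hy.
by move=> i; apply: decoupled_om Gx Gy yom gx hy.
Qed.

Lemma decoupled_orth x y : generator x -> subA Kom x -> generator y ->
  subA Kom y ->
  orth_proj Kperp (wbr x y) 0.
Proof.
move=> Gx xom Gy yom; split; first exact: span0.
rewrite subr0 wbrE; apply: (span_of_msupp (P := fun g => ~ in_cls Kperp g)).
- by move=> g; rewrite in_cls_dag.
- exact: (wdag_wbr (skew_generator Gx) (skew_generator Gy)).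
move=> mu /wbr_supp[g [h [gx hy mugh]]]; apply: diag_not_perp.
apply: om_om_bracket mugh.
- exact: subA_msupp xom _ gx.
- exact: subA_msupp yom _ hy.
- by move=> i; apply: decoupled_om Gx Gy yom gx hy.
by move=> i; apply: decoupled_om Gy Gx xom hy gx.
Qed.

End Decoupled.

(** * From conditions (i)-(iv) to decoupling *)

Section Converse.
Context (hnot1 : forall p : I, ~ subA K1 (gsig R (sigma p) (gamma p))).
Context (not_perp : forall x, ~ (generator x /\ subA Kperp x)).
Context (central : forall x y, generator x -> subA Keq x -> generator y ->
  wbr x y = 0).
Context (quadratic : forall x y, generator x -> subA K2 x -> generator y ->
  subA Kom y ->
  subA Kom (wbr x y)).
Context (orth : forall x y, generator x -> subA Kom x -> generator y ->
  subA Kom y ->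
  orth_proj Kperp (wbr x y) 0).

Lemma generator_gsig p : generator (gs (sigma p) (gamma p)).
Proof. by right; exists p; rewrite gsig_E. Qed.

Lemma gamma_not_perp p : ~ clsperp (gamma p).
Proof.
move=> gp; apply: not_perp; split; first exact: generator_gsig.
exact: subA_gsig.
Qed.

Lemma gamma_not_linear p : ~ cls1 (gamma p).
Proof.
by move=> g1; apply: (hnot1 (p := p)); rewrite gsig_E; apply: subA_gsig.
Qed.

Lemma gamma_classes p :
  [\/ cls0 (gamma p), cls2 (gamma p), clseq (gamma p) | clsom (gamma p)].
Proof.
apply: contrapT => N; apply: (gamma_not_perp (p := p)).
split; first by move=> g0; apply: N; apply: Or41.
split; first exact: gamma_not_linear.
split; first by move=> g2; apply: N; apply: Or42.
by split=> [ge|go]; apply: N; [apply: Or43|apply: Or44].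
Qed.

(** Contracting mode [i] against [gamma q] or its adjoint gives two monomials whose weights in mode
    [l] are the sum and the difference of those of the factors. They cannot both vanish, since
    [gamma q] has nonzero weight there. *)
Lemma om_witness p q i : clsom (gamma q) -> (gamma p).1 i != (gamma p).2 i ->
    (1 < (gamma q).1 i + (gamma q).2 i)%N ->
  exists l mu, [/\ i != l, mu.1 i != mu.2 i, mu.1 l != mu.2 l,
    mu \in msupp (wbrF (gs (sigma p) (gamma p)) (gs (sigma q) (gamma q))) &
    (Defs.mdeg mu + 2 = Defs.mdeg (gamma p) + Defs.mdeg (gamma q))%N].
Proof.
move=> /clsom_off_diag[l hl [hlN hd]] gi hi.
have il : i != l by apply: contraTneq hi => ->; rewrite hl.
have hiE := hd i il; have h0 : (0 < (gamma q).1 i)%N by move: hi; rewrite hiE;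
  lia.
have [m1 m2] := wbr_gsig_msupp (@conjc R) (iC_neq0 R) (sigma p) (hbasis q) gi
  hiE h0.
have li : (l == i) = false by apply/negbTE; rewrite eq_sym.
pose mu1 := shift1 (gamma p) (gamma q) i; pose mu2 :=
  shift1 (gamma p) (dag (gamma q)) i.
have d1 := @mdeg_shift1 n (gamma p) (gamma q) i.
have d2 := @mdeg_shift1 n (gamma p) (dag (gamma q)) i.
rewrite mdeg_dag /= in d2.
have [w1|w1] := eqVneq (mu1.1 l) (mu1.2 l); last first.
  exists l, mu1; split=> //; first by rewrite /mu1 /= !ffunE eqxx /=;
    move: gi h0; lia.
  by apply: d1; lia.
exists l, mu2; split=> //.
- by rewrite /mu2 /= !ffunE eqxx /=; move: gi h0; lia.
- by move: w1; rewrite /mu1 /mu2 /= !ffunE li /=; move: hlN; lia.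
by apply: d2; lia.
Qed.

Lemma converse_decoupled : decoupled.
Proof.
split.
- by move=> g [[k ->]|[p ->]]; [exact: diag_not_perp|exact: gamma_not_perp].
- move=> g h i [[k ->]|[p ->]]; first by rewrite num_mono_diag eqxx.
  move=> [[k ->]|[q ->]]; first by case=> _; rewrite num_mono_mdeg.
  move=> heq gi; apply/eqP; rewrite -leqn0 leqNgt; apply/negP => h0.
  have [hd _] := heq; have hi : (gamma q).1 i = (gamma q).2 i by rewrite hd.
  have [m1 _] := wbr_gsig_msupp (@conjc R) (iC_neq0 R) (sigma p) (hbasis q) gi
    hi h0.
  have := central (generator_gsig q) (subA_gsig R (hbasis q) (K := Keq) heq)
    (generator_gsig p).
  rewrite wbrE => br0; move: m1; rewrite wbrC br0 oppr0 msupp0.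
  by rewrite in_fset0.
move=> g h i [[k ->]|[p ->]]; first by rewrite num_mono_diag eqxx.
move=> [[k ->]|[q ->]]; first by case; rewrite num_mono_mdeg.
move=> hom gi; rewrite leqNgt; apply/negP => hi.
have [l [mu [il mui mul mubr dmu]]] := om_witness hom gi hi.
have Gq := generator_gsig q; have Gp := generator_gsig p.
have qom := subA_gsig R (hbasis q) (K := Kom) hom.
have [[gd _]|g2|[gd _]|gom] := gamma_classes p.
- by rewrite gd eqxx in gi.
- have := quadratic Gp (subA_gsig R (hbasis p) (K := K2) g2) Gq qom.
  rewrite wbrE => /subA_msupp/(_ mu mubr).
  exact: two_weights_not_om il mui mul.
- by rewrite gd eqxx in gi.
have [_] := orth Gp (subA_gsig R (hbasis p) (K := Kom) gom) Gq qom.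
rewrite subr0 wbrE => /(span_msupp (P := fun g => ~ in_cls Kperp g)) np.
apply: (np _ mu mubr) => [g' |]; first by rewrite in_cls_dag.
(* Two factors of degree at least 3 and one contraction leave degree at least 4, so the witness is
   of type perp. *)
apply: two_weights_perp il mui mul _.
by case: hom gom dmu => dq _ [dp _]; lia.
Qed.

End Converse.

(** The set S of the boundedness argument: modes that a generator of type = or om occupies through
    number operators. *)
Definition diagonal_modes : pred 'I_n := fun i => `[< exists p,
  (clseq (gamma p) /\ (0 < (gamma p).1 i)%N) \/
  (clsom (gamma p) /\ (1 < (gamma p).1 i + (gamma p).2 i)%N) >].

Lemma mdeg_split (S : pred 'I_n) g : (forall j, S j -> g.1 j = g.2 j) ->
  (Defs.mdeg g = \sum_(j | ~~ S j) (g.1 j + g.2 j) + (\sum_(j | S j) g.1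
    j).*2)%N.
Proof.
move=> gS; rewrite /Defs.mdeg (bigID S) /= addnC; congr (_ + _)%N.
by rewrite -addnn -big_split /=; apply: eq_bigr => j /gS ->.
Qed.

Lemma decoupled_findim : (forall p, ~ cls1 (gamma p)) -> decoupled ->
  fin_dim (lie_gen generator).
Proof.
(* [m] exceeds the degree of every generator: one of type om costs at most m for its odd operator
   and less than m for its number operators, within the bound 2 m. *)
move=> not1 [np ceq com]; set m := (\sum_p Defs.mdeg (gamma p)).+1.
have m0 : (0 < m)%N by [].
pose S := diagonal_modes; pose tm := tame S m.
have gS g : leading g -> forall j, S j -> g.1 j = g.2 j.
  move=> lg j /asboolP[p Hp]; apply/eqP/negPn/negP => gj.
  have lp : leading (gamma p) by right; exists p.
  case: Hp => -[pc pj]; first by rewrite (ceq g (gamma p) j lg lp pc gj) in pj.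
  by have := com g (gamma p) j lg lp pc gj; rewrite leqNgt pj.
have small g : (forall j, S j -> g.1 j = g.2 j) -> (Defs.mdeg g <= 2)%N -> tm g.
  move=> gd; rewrite (mdeg_split gd) => d2; split=> //; move: d2.
  move: (\sum_(j | S j) _)%N (\sum_(j | ~~ S j) _)%N => b a.
  by move: (m) m0 => k k0; case: a => [|[|[|a]]]; case: b => [|[|b]] //; lia.
have lead_tame g : leading g -> tm g.
  move=> lg; have gd := gS g lg.
  case: (lg) => [[k gE]|[p gE]]; first by apply: small => //;
    rewrite gE num_mono_mdeg.
  have dm : (Defs.mdeg g < m)%N by rewrite /m gE (bigD1 p) //= ltnS leq_addr.
  have [d2|d3] := leqP (Defs.mdeg g) 2; first exact: small.
  have := dm; rewrite (mdeg_split gd) => dm'.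
  have [ge|go] : clseq g \/ clsom g.
    apply: contrapT => N; apply: (np g lg); split; first by case=> _ [] d;
      rewrite d in d3.
    split; first by rewrite gE; apply: not1.
    split; first by case=> d; rewrite d in d3.
    by split=> H; apply: N; [left|right].
  (* Every mode occupied by a generator of type = lies in [S], so the part off [S] is empty. *)
  - split=> //; rewrite big1 => [|j Sj].
      move: dm'; move: (\sum_(j | S j) _)%N (\sum_(j | ~~ S j) _)%N => b a.
      by move: (m) m0 => k k0; lia.
    have g0 : g.1 j = 0%N.
      apply/eqP; rewrite -leqn0 leqNgt; apply: contra Sj => gj.
      by apply/asboolP; exists p; left; rewrite -gE.
    by have [gdd _] := ge; rewrite -gdd g0.
  have [l gl [_ god]] := clsom_off_diag go.
  split=> //; have le1 : (\sum_(j | ~~ S j) (g.1 j + g.2 j) <= 1)%N.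
    (* A mode holding two or more operators of a type om generator lies in [S], so off [S] only the
       odd operator can remain. *)
    have off j : ~~ S j -> (g.1 j + g.2 j <= (j == l))%N.
      move=> Sj; have le : (g.1 j + g.2 j <= 1)%N.
        rewrite leqNgt; apply: contra Sj => gj.
        by apply/asboolP; exists p; right; rewrite -gE.
      by have [->|jl] := eqVneq j l; [rewrite gl|have := god j jl; lia].
    apply: (leq_trans (leq_sum _ off)); rewrite (leq_trans (n :=
      \sum_j (j == l))) //.
      by rewrite [X in (_ <= X)%N](bigID (fun j => ~~ S j)) leq_addr.
    by rewrite (bigD1 l) //= eqxx big1 // => j /negPf ->.
  move: dm' le1; move: (\sum_(j | S j) _)%N (\sum_(j | ~~ S j) _)%N => b a.
  by move: (m) m0 => k k0; case: a => [|[|]] //; lia.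
have dag_tame g : tm g -> tm (dag g).
  move=> [gd ge]; split; first by move=> j /gd.
  rewrite /= (eq_bigr (fun j => g.1 j + g.2 j)%N) => [|j _];
    last by rewrite addnC.
  by rewrite [X in (_ + X)%N](eq_bigr (fun j => g.1 j)) // => j /gd.
apply: (@fin_dim_box R n _ m.*2.+3) => x Lx mu mux j;
  apply: (tame_bound m0 (S := S)).
suff : tame_elt S m x by apply.
elim: Lx {mu mux j} => [y|//|y z _ ty _ tz|r y _ ty|y z _ ty _ tz].
- case/generator_leading => g [lg _ _ yg] mu /yg[->|->];
  last exact/dag_tame/lead_tame.
  exact: lead_tame.
- by move=> mu; rewrite msupp0 in_fset0.
- by rewrite -[y]scale1r -[z]scale1r; apply: tame_elt_comb.
- by rewrite -[_ *: y]addr0 -(scale0r y); apply: tame_elt_comb.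
by rewrite wbrE; apply: tame_elt_wbr.
Qed.

End Generators.

Theorem theorem5 (R : realType) (n : nat) (n_gt0 : (0 < n)%N)
  (I : finType) (sigma : I -> bool) (gamma : I -> mono n)
  (hbasis : forall p : I, is_basis (sigma p) (gamma p))
  (hnot1 : forall p : I, ~ subA (K1) (gsig R (sigma p) (gamma p))) :
  let G : weyl R n -> Prop := fun x =>
    (exists k : 'I_n, x = iC R *: amon R (num_mono k)) \/
    (exists p : I, x = gsig R (sigma p) (gamma p)) in
  let GK (K : cls) : weyl R n -> Prop := fun x => G x /\ subA K x in
  let cG : weyl R n -> Prop := fun x => G x /\ forall y, G y -> wbr x y = 0 in
  fin_dim (lie_gen G) <->
  [/\ (forall x, ~ GK Kperp x),
      (forall x, GK Keq x -> cG x),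
      (forall x y, GK K2 x -> GK Kom y -> subA Kom (wbr x y)) &
      (forall x y, GK Kom x -> GK Kom y -> orth_proj Kperp (wbr x y) 0)].
Proof.
move=> G GK cG; split=> [fd|[c1 c2 c3 c4]].
  have dec := findim_decoupled hbasis fd; split.
  - exact: decoupled_not_perp hbasis dec.
  - by move=> x [Gx xeq]; split=> // y;
    apply: decoupled_central hbasis dec _ _ Gx xeq.
  - by move=> x y [Gx x2] [Gy yom];
    apply: decoupled_quadratic hbasis dec _ _ Gx x2 Gy yom.
  by move=> x y [Gx xom] [Gy yom];
    apply: decoupled_orth hbasis dec _ _ Gx xom Gy yom.
have dec : decoupled gamma.
  apply: (converse_decoupled hbasis hnot1 c1).
  - by move=> x y Gx xeq Gy; have [_] := c2 x (conj Gx xeq); apply.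
  - by move=> x y Gx x2 Gy yom; apply: c3.
  by move=> x y Gx xom Gy yom; apply: c4.
exact: (decoupled_findim R hbasis (gamma_not_linear hbasis hnot1) dec).
Qed.
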